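(* Suppose $K$ is a compact metrizable space, and $X$ is a Banach space. Then the following are equivalent: (1) $K$ is scattered, and $X$ is subprojective; (2) $C(K,X)$ is subprojective.
   Context: All Banach spaces (in particular $X$ and $C(K,X)$) are assumed infinite dimensional. $C(K,X)$ is the Banach space of continuous functions $K\to X$ with the supremum norm. A topological space is scattered if every (nonempty) compact subset of it has an isolated point. A Banach space $X$ is subprojective if every closed infinite dimensional subspace $Y \subset X$ contains a closed infinite dimensional subspace $Z \subset Y$ that is complemented in $X$. *)

(* Defs.v *)
From HB Require Import structures.
From mathcomp Require Import all_boot all_order all_algebra.
From mathcomp Require Import all_classical all_reals all_analysis.
From mathcomp Require Export complex.
Set Implicit Arguments.
Unset Strict Implicit.
Unset Printing Implicit Defensive.
Import Order.TTheory GRing.Theory Num.Theory.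
Import numFieldNormedType.Exports.
Local Open Scope classical_set_scope.
Local Open Scope ring_scope.
Local Open Scope complex_scope.

Definition metrizable (R : realType) (T : topologicalType) :=
  exists d : T -> T -> R,
    [/\ forall x y, d x y = 0 <-> x = y,
        forall x y, d x y = d y x,
        forall x y z, d x z <= d x y + d y z
      & forall (x : T) (A : set T),
          nbhs x A <-> exists2 e : R, 0 < e & [set y | d x y < e] `<=` A].

Definition scattered (T : topologicalType) :=
  forall A : set T, A !=set0 -> compact A -> isolated A !=set0.

Section subspaces.
Context {F : numFieldType} {X : normedModType F}.

Definition closed_subspace (Y : set X) :=
  [/\ Y 0, forall (a : F) u v, Y u -> Y v -> Y (a *: u + v) & closed Y].

Definition finite_dimensional (Y : set X) :=
  exists n (e : 'I_n -> X), Y = [set \sum_i c i *: e i | c in [set: 'I_n -> F]].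

Definition infinite_dimensional (Y : set X) := ~ finite_dimensional Y.

Definition complemented (Z : set X) :=
  exists P : {linear X -> X},
    [/\ continuous P, forall x, P (P x) = P x & range P = Z].

End subspaces.

Definition subprojective (F : numFieldType) (X : normedModType F) :=
  forall Y : set X, closed_subspace Y -> infinite_dimensional Y ->
  exists Z : set X, [/\ Z `<=` Y, closed_subspace Z, infinite_dimensional Z
                      & complemented Z].

(* This holds for the real and for the complex numbers, and makes the supremum
   norm below well defined over either scalar field; over R[i] the order is
   partial and the norm is the real number seen in R[i]. *)
Definition has_nonneg_suprema (F : numFieldType) :=
  forall A : set F, A !=set0 -> (forall x, A x -> 0 <= x) -> ubound A !=set0 ->
  supremums A !=set0.

Lemma real_has_nonneg_suprema (R : realType) : has_nonneg_suprema R.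
Proof.
move=> A A0 _ uA; exists (sup A); have hA : has_sup A by split.
split; first exact: sup_upper_bound.
by move=> y Ay; exact: ge_sup.
Qed.

Lemma complex_has_nonneg_suprema (R : realType) : has_nonneg_suprema R[i].
Proof.
move=> A [a Aa] Age0 [M AM].
have hB : has_sup [set complex.Re z | z in A].
  split; first by exists (complex.Re a), a.
  exists (complex.Re M) => _ [z Az <-].
  by have := AM _ Az; rewrite lecE => /andP[].
exists (sup [set complex.Re z | z in A])%:C; split.
  move=> z Az; have := Age0 _ Az; rewrite !lecE /= => /andP[/eqP -> _].
  by rewrite eqxx /=; apply: sup_upper_bound => //; exists z.
move=> w Aw; have := Aw _ Aa; have := Age0 _ Aa.
rewrite !lecE /= => /andP[/eqP -> _] /andP[/eqP -> _]; rewrite eqxx /=.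
apply: ge_sup; first by case: hB.
by move=> _ [z Az <-]; have := Aw _ Az; rewrite lecE => /andP[].
Qed.

Arguments real_has_nonneg_suprema : clear implicits.
Arguments complex_has_nonneg_suprema : clear implicits.

(* The compactness of K and the existence of suprema in F are part of the type,
   since they are what makes the supremum norm a norm. *)
Definition continuous_space (F : numFieldType) (hF : has_nonneg_suprema F)
    (K : topologicalType) (cK : compact [set: K]) (X : normedModType F) :=
  continuousType K X.

Notation "'C[' hF ]( cK , X )" := (continuous_space hF cK X)
  (at level 0, format "'C[' hF ]( cK ,  X )").

Section continuous_space.
Context {F : numFieldType} (hF : has_nonneg_suprema F).
Context {K : topologicalType} (cK : compact [set: K]) (X : normedModType F).
Local Notation CKX := C[hF](cK, X).
Implicit Types f g : CKX.

HB.instance Definition _ := gen_eqMixin CKX.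
HB.instance Definition _ := gen_choiceMixin CKX.

Definition csp_fun (f : CKX) : K -> X := f.

Definition csp_mk (f : K -> X) (cf : continuous f) : CKX :=
  [the continuousType K X of mkcts cf].

Lemma csp_ext f g : csp_fun f =1 csp_fun g -> f = g.
Proof. by move=> fg; apply/continuousEP. Qed.

Lemma csp_cts f : continuous (csp_fun f).
Proof. exact: cts_fun. Qed.

Let cst0 : continuous (fun _ : K => 0 : X).
Proof. by move=> x; exact: cvg_cst. Qed.
Let opp_cts f : continuous (fun x => - csp_fun f x).
Proof. by move=> x; apply: cvgN; exact: csp_cts. Qed.
Let add_cts f g : continuous (fun x => csp_fun f x + csp_fun g x).
Proof. by move=> x; apply: cvgD; exact: csp_cts. Qed.
Let scale_cts (a : F) f : continuous (fun x => a *: csp_fun f x).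
Proof. by move=> x; apply: cvgZr; exact: csp_cts. Qed.

Definition csp_zero : CKX := csp_mk cst0.
Definition csp_opp f : CKX := csp_mk (@opp_cts f).
Definition csp_add f g : CKX := csp_mk (@add_cts f g).
Definition csp_scale a f : CKX := csp_mk (@scale_cts a f).

Let addA : associative csp_add.
Proof. by move=> f g h; apply: csp_ext => x; exact: addrA. Qed.
Let addC : commutative csp_add.
Proof. by move=> f g; apply: csp_ext => x; exact: addrC. Qed.
Let add0 : left_id csp_zero csp_add.
Proof. by move=> f; apply: csp_ext => x; exact: add0r. Qed.
Let addN : left_inverse csp_zero csp_opp csp_add.
Proof. by move=> f; apply: csp_ext => x; exact: addNr. Qed.

HB.instance Definition _ := GRing.isZmodule.Build CKX addA addC add0 addN.

Let scaleA a b f : csp_scale a (csp_scale b f) = csp_scale (a * b) f.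
Proof. by apply: csp_ext => x; exact: scalerA. Qed.
Let scale1 : left_id 1 csp_scale.
Proof. by move=> f; apply: csp_ext => x; exact: scale1r. Qed.
Let scaleDr : right_distributive csp_scale +%R.
Proof. by move=> a f g; apply: csp_ext => x; exact: scalerDr. Qed.
Let scaleDl f : {morph csp_scale^~ f : a b / a + b}.
Proof. by move=> a b; apply: csp_ext => x; exact: scalerDl. Qed.

HB.instance Definition _ :=
  GRing.Zmodule_isLmodule.Build F CKX scaleA scale1 scaleDr scaleDl.

Definition csp_norm f : F := supremum 0 [set `|csp_fun f x| | x in [set: K]].

Lemma csp_bounded f : exists M : F, forall x, `|csp_fun f x| <= M.
Proof.
have : compact (csp_fun f @` [set: K]).
  by apply: continuous_compact => //; apply: continuous_subspaceT; exact: csp_cts.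
rewrite compact_cover => /(_ X setT (fun y => ball y 1)); case.
- by move=> y _; exact: ball_open.
- by move=> y _; exists y => //; exact: ballxx.
move=> D _ DK.
exists (\sum_(y <- finmap.enum_fset D) `|y| + 1) => x.
have [|y /= yD] := DK (csp_fun f x); first by exists x.
rewrite -ball_normE /= distrC => yx.
rewrite -(subrK y (csp_fun f x)) addrC (le_trans (ler_normD _ _))//.
rewrite lerD ?(ltW yx)// (big_rem y) //= lerDl.
exact: sumr_ge0.
Qed.

Lemma csp_norm_supremums f :
  [set `|csp_fun f x| | x in [set: K]] !=set0 ->
  supremums [set `|csp_fun f x| | x in [set: K]] !=set0.
Proof.
move=> f0; apply: hF => //; first by move=> _ [x _ <-].
by have [M HM] := csp_bounded f; exists M => _ [x _ <-].
Qed.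

Lemma le_csp_norm f x : `|csp_fun f x| <= csp_norm f.
Proof.
have f0 : [set `|csp_fun f x| | x in [set: K]] !=set0 by exists `|csp_fun f x|, x.
rewrite /csp_norm /supremum ifN; last exact/set0P.
case: xgetP => [y _ [fy _]|]; first by apply: fy; exists x.
by have [s ss] := csp_norm_supremums f0 => /(_ s).
Qed.

Lemma csp_norm_le f (M : F) :
  0 <= M -> (forall x, `|csp_fun f x| <= M) -> csp_norm f <= M.
Proof.
move=> M0 fM; rewrite /csp_norm /supremum; case: ifPn => // /set0P f0.
case: xgetP => [y _ [_ /(_ M)]|].
  by apply=> _ [x _ <-].
by have [s ss] := csp_norm_supremums f0 => /(_ s).
Qed.

Lemma csp_norm_ge0 f : 0 <= csp_norm f.
Proof.
have [[x _]|K0] := pselect ([set: K] !=set0).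
  by rewrite (le_trans _ (le_csp_norm f x)).
rewrite /csp_norm (_ : [set _ | _ in _] = set0) ?supremum0//.
by apply/seteqP; split=> // y [x _ _]; apply: K0; exists x.
Qed.

Let normD f g : csp_norm (f + g) <= csp_norm f + csp_norm g.
Proof.
apply: csp_norm_le; first by rewrite addr_ge0 ?csp_norm_ge0.
by move=> x; rewrite (le_trans (ler_normD _ _))// lerD// le_csp_norm.
Qed.

Let normZ_le (a : F) f : csp_norm (a *: f) <= `|a| * csp_norm f.
Proof.
apply: csp_norm_le; first by rewrite mulr_ge0 ?csp_norm_ge0.
move=> x; rewrite (_ : csp_fun (a *: f) x = a *: csp_fun f x)// normrZ.
by rewrite ler_wpM2l// le_csp_norm.
Qed.

Let normZ (a : F) f : csp_norm (a *: f) = `|a| * csp_norm f.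
Proof.
apply/eqP; rewrite eq_le normZ_le /=.
have [->|a0] := eqVneq a 0; first by rewrite normr0 mul0r csp_norm_ge0.
rewrite -ler_pdivlMl ?normr_gt0// -normfV.
by rewrite -{1}(scale1r f) -(mulVf a0) -scalerA normZ_le.
Qed.

Let norm0 f : csp_norm f = 0 -> f = 0.
Proof.
move=> f0; apply: csp_ext => x; apply/eqP.
by rewrite -normr_le0 -f0 le_csp_norm.
Qed.

HB.instance Definition _ := Lmodule_isNormed.Build F CKX normD normZ norm0.

Lemma csp_normE f : `|f| = supremum 0 [set `|csp_fun f x| | x in [set: K]].
Proof. by []. Qed.

End continuous_space.

Section continuous_space_complete.
Context {F : numFieldType} (hF : has_nonneg_suprema F).
Context {K : topologicalType} (cK : compact [set: K]).
Context (X : completeNormedModType F).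
Local Notation CKX := C[hF](cK, X).

Lemma csp_complete (G : set_system CKX) : ProperFilter G -> cauchy G -> cvg G.
Proof.
move=> PG /cauchy_ballP cG.
have cG2 (e : F) : 0 < e -> \forall f \near G & g \near G, csp_norm (f - g) <= e.
  move=> e0; have := cG _ e0; apply: filterS => -[f g].
  by rewrite -ball_normE /=; exact: ltW.
have clim x : cvg ((fun f : CKX => csp_fun f x) @ G).
  apply: cauchy_cvg; apply/cauchy_ballP => e e0.
  have /cG [[A B] /= [GA GB] AB] := e0.
  exists ([set csp_fun f x | f in A], [set csp_fun f x | f in B]) => /=.
    by split; [apply: filterS GA|apply: filterS GB] => f; exists f.
  move=> [_ _] /= [[f Af <-] [g Bg <-]].
  have := AB (f, g) (conj Af Bg); rewrite -!ball_normE /=.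
  by apply: le_lt_trans; exact: (le_csp_norm (f - g)).
pose l x := lim ((fun f : CKX => csp_fun f x) @ G).
have ul (e : F) : 0 < e ->
    \forall f \near G, forall x, `|l x - csp_fun f x| <= e.
  move=> e0; have e20 : 0 < e / 2 by rewrite divr_gt0.
  have /nearP_dep := cG2 _ e20; apply: filterS => f Gf x.
  have /cvgrPdist_le /(_ _ e20) /= Gl := clim x.
  have [g [fg gl]] := filter_ex (filterI Gf Gl).
  rewrite -(subrK (csp_fun g x) (l x)) -addrA (splitr e).
  rewrite (le_trans (ler_normD _ _))// lerD// distrC.
  exact: le_trans (le_csp_norm (f - g) x) fg.
have cl : continuous l.
  move=> x; apply/cvgrPdist_le => e e0.
  have e30 : 0 < e / 3%:R by rewrite divr_gt0.
  have [f fl] := filter_ex (ul _ e30).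
  have := @csp_cts _ hF _ cK X f x => /cvgrPdist_le /(_ _ e30).
  apply: filterS => y /= fxy.
  have -> : l x - l y = (l x - csp_fun f x) + (csp_fun f x - csp_fun f y)
      - (l y - csp_fun f y).
    by rewrite opprB !subrKA.
  have -> : e = e / 3%:R + e / 3%:R + e / 3%:R.
    by rewrite -!mulrDl -mulr2n -mulrSr -(mulr_natr e 3) mulfK ?pnatr_eq0.
  by rewrite (le_trans (ler_normB _ _))// lerD// (le_trans (ler_normD _ _))// lerD.
apply/cvg_ex; exists (csp_mk hF cK cl); apply/cvgrPdist_le => e e0.
have := ul _ e0; apply: filterS => f fl; apply: csp_norm_le => //.
exact: ltW.
Qed.

HB.instance Definition _ := Uniform_isComplete.Build CKX csp_complete.

End continuous_space_complete.

(* Main.v *)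
Require Import Defs.
From HB Require Import structures.
From mathcomp Require Import all_boot all_order all_algebra.
From mathcomp Require Import all_classical all_reals all_analysis.
From mathcomp Require Import complex.
From mathcomp Require Import ring lra.
Import Order.TTheory GRing.Theory Num.Theory.
Import numFieldNormedType.Exports.
Local Open Scope classical_set_scope.
Local Open Scope ring_scope.
Local Open Scope complex_scope.

Set Implicit Arguments.
Unset Strict Implicit.
Unset Printing Implicit Defensive.

(** Write N for the norm and C(K,X) for the space of continuous functions.

  Scattered K and subprojective X give subprojective C(K,X). Let Y be a closed
  infinite-dimensional subspace containing no infinite-dimensional complemented
  subspace. If evaluation at a point were bounded below on a subspace of Y,
  subprojectivity of X would pull back ([complemented_pullback]); so it never is,
  and points are null for Y: restriction to them is strictly singular on Y. Null sets
  are stable under finite unions, because a seminorm that is bounded below on no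
  subspace is small on a whole subspace ([singular_hereditary]). By compactness
  some point has no null neighbourhood, as K itself is not null, and the closed set
  of such points has an isolated point p. Around p every closed annulus is null, so a
  gliding hump gives vectors of Y that are small at p and peak at points t_k tending
  to p. They span a copy of c_0, which is complemented by means of the functionals
  [f |-> phi_k (f t_k - f p)] ([gliding_hump]).

  For the converse, X is a space of constant functions in C(K,X), and it inherits
  subprojectivity. If K is not scattered, it contains a perfect compact set, and a tree
  argument gives functions r_k from K to [-1,1] that take every pattern of signs at
  some point ([perfect_independent], [compact_independent]). For a unit vector x of X,
  the functions [r_k x] span a copy Y of l_1. If Z in Y were infinite-dimensional and
  the range of a projection P, the coordinates of [P f] would be absolutely summable
  for all f in C(K,X), with sum at most a multiple of [N f]. Vectors of Z with
  coordinates mostly in successive blocks then give functionals T_j with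
  [\sum_j N (T_j f) <= D * N f] that stay large at vectors z_j of norm 1. Averaging over
  Riesz products excludes this ([riesz_product_sum]).

  Real and complex scalars are treated together, and all estimates are made with a
  norm that takes real values. *)

(** * Real and complex scalars *)

(** What the proof uses of F, for F the real or the complex numbers: every scalar
  is [emb (rpart z) + iunit * emb (ipart z)]. Over the real numbers [iunit] and
  [ipart] are 0. *)
Record scalars (R : realType) (F : numFieldType) := Scalars {
  emb : {rmorphism R -> F};
  rpart : F -> R;
  ipart : F -> R;
  iunit : F;
  emb_le : forall r s, (emb r <= emb s) = (r <= s);
  rpartD : forall x y, rpart (x + y) = rpart x + rpart y;
  ipartD : forall x y, ipart (x + y) = ipart x + ipart y;
  rpartZ : forall r z, rpart (emb r * z) = r * rpart z;
  ipartZ : forall r z, ipart (emb r * z) = r * ipart z;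
  rpart_emb : forall r, rpart (emb r) = r;
  rpart_iunit : forall r, rpart (iunit * emb r) = 0;
  rpart_le : forall z, emb `|rpart z| <= `|z|;
  ipart_le : forall z, emb `|ipart z| <= `|z|;
  partsE : forall z, z = emb (rpart z) + iunit * emb (ipart z);
  emb_rpart_ge0 : forall z, 0 <= z -> emb (rpart z) = z;
  iunit_le1 : `|iunit| <= 1;
  iunit_cases : iunit = 0 \/ iunit * iunit = -1 }.

Lemma real_partsE (R : realType) : forall z : R,
  z = (idfun : {rmorphism R -> R}) z + 0 * (idfun : {rmorphism R -> R}) 0.
Proof. by move=> z; rewrite mul0r addr0. Qed.

Definition real_scalars (R : realType) : scalars R R.
Proof.
refine (@Scalars R R (idfun : {rmorphism R -> R}) id (fun _ => 0) 0
  _ _ _ _ _ _ _ _ _ (@real_partsE R) _ _ _) => //=.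
- by move=> x y; rewrite addr0.
- by move=> r z; rewrite mulr0.
- by move=> r; rewrite mul0r.
- by move=> z; rewrite normr0.
- by rewrite normr0 ler01.
- by left.
Defined.

Section complex_scalars.
Variable R : realType.

Lemma complex_part_le (a b : R) :
  real_complex R `|a| <= `|a +i* b| :> R[i] /\ real_complex R `|b| <= `|a +i* b| :> R[i].
Proof.
rewrite normc_def /= !lecR -!sqrtr_sqr.
by split; apply: ler_wsqrtr; rewrite ?lerDl ?lerDr ?sqr_ge0.
Qed.

Definition complex_scalars : scalars R R[i].
Proof.
refine (@Scalars R R[i] (real_complex R) (@complex.Re R) (@complex.Im R) (Complex 0 1)
  _ _ _ _ _ _ _ _ _ _ _ _ _) => //=.
- by move=> r s; rewrite lecR.
- by move=> [a b] [c d].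
- by move=> [a b] [c d].
- by move=> r [a b] /=; rewrite mul0r subr0.
- by move=> r [a b] /=; rewrite mul0r addr0.
- by move=> r /=; rewrite mul0r mulr0 subrr.
- by move=> [a b]; case: (complex_part_le a b).
- by move=> [a b]; case: (complex_part_le a b).
- by move=> z; rewrite {1}(complexE z).
- by move=> z z0; apply: RRe_real; exact: ger0_real.
- by rewrite normc_def /= expr0n expr1n add0r sqrtr1.
- by right; rewrite -expr2 sqr_i.
Defined.

End complex_scalars.

Section real_norm.
Context {R : realType} {F : numFieldType} (sc : scalars R F).
Local Notation "r %:F" := (emb sc r).

Lemma emb_lt r s : (r%:F < s%:F) = (r < s).
Proof. by rewrite !lt_neqAle emb_le (inj_eq (fmorph_inj _)). Qed.

Lemma emb_ge0 r : (0 <= r%:F) = (0 <= r).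
Proof. by rewrite -(rmorph0 (emb sc)) emb_le. Qed.

Lemma emb_gt0 r : (0 < r%:F) = (0 < r).
Proof. by rewrite -(rmorph0 (emb sc)) emb_lt. Qed.

Lemma norm_emb r : `|r%:F| = `|r|%:F.
Proof.
have [r0|r0] := leP 0 r; first by rewrite !ger0_norm // emb_ge0.
by rewrite (ltr0_norm r0) -[LHS]normrN -rmorphN ger0_norm // emb_ge0 oppr_ge0 ltW.
Qed.

Lemma emb_gt0_ex e : 0 < e -> exists2 r, 0 < r & e = r%:F.
Proof.
move=> e0; exists (rpart sc e); last by rewrite emb_rpart_ge0 // ltW.
by rewrite -emb_gt0 emb_rpart_ge0 // ltW.
Qed.

(** The norm as an element of R, where the order is total, instead of F. *)
Definition nrm (X : normedModType F) (x : X) : R := rpart sc `|x|.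

Lemma nrmE (X : normedModType F) (x : X) : (nrm x)%:F = `|x|.
Proof. exact: emb_rpart_ge0. Qed.

Lemma nrm_le (X : normedModType F) (x : X) r : (nrm x <= r) = (`|x| <= r%:F).
Proof. by rewrite -nrmE emb_le. Qed.

Lemma nrm_lt (X : normedModType F) (x : X) r : (nrm x < r) = (`|x| < r%:F).
Proof. by rewrite -nrmE emb_lt. Qed.

Section one_space.
Variable X : normedModType F.
Implicit Types x y z : X.

Lemma nrm_ge0 x : 0 <= nrm x.
Proof. by rewrite -emb_ge0 nrmE. Qed.

Lemma nrm0 : nrm (0 : X) = 0.
Proof. by apply: (fmorph_inj (emb sc)); rewrite nrmE normr0 rmorph0. Qed.

Lemma nrm_eq0 x : nrm x = 0 -> x = 0.
Proof. by move=> x0; apply/eqP; rewrite -normr_eq0 -nrmE x0 rmorph0. Qed.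

Lemma nrm_gt0 x : x <> 0 -> 0 < nrm x.
Proof.
by move=> x0; rewrite lt_neqAle nrm_ge0 andbT eq_sym; apply/eqP => /nrm_eq0.
Qed.

Lemma nrmD x y : nrm (x + y) <= nrm x + nrm y.
Proof. by rewrite nrm_le rmorphD !nrmE ler_normD. Qed.

Lemma nrmZ a x : nrm (a *: x) = nrm (a : F^o) * nrm x.
Proof. by apply: (fmorph_inj (emb sc)); rewrite rmorphM !nrmE normrZ. Qed.

Lemma nrmZr r x : nrm (r%:F *: x) = `|r| * nrm x.
Proof.
by apply: (fmorph_inj (emb sc)); rewrite rmorphM !nrmE normrZ norm_emb.
Qed.

Lemma nrmN x : nrm (- x) = nrm x.
Proof. by apply: (fmorph_inj (emb sc)); rewrite !nrmE normrN. Qed.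

Lemma nrmB x y : nrm (x - y) <= nrm x + nrm y.
Proof. by rewrite -(nrmN y) nrmD. Qed.

Lemma nrm_distC x y : nrm (x - y) = nrm (y - x).
Proof. by rewrite -nrmN opprB. Qed.

Lemma nrm_triangle y x z : nrm (x - z) <= nrm (x - y) + nrm (y - z).
Proof. by rewrite -(subrKA y) nrmD. Qed.

Lemma nrm_le_dist x y : nrm x <= nrm y + nrm (x - y).
Proof. by rewrite -{1}(subrK y x) addrC nrmD. Qed.

Lemma nrm_big_sum (I : finType) (u : I -> X) : nrm (\sum_i u i) <= \sum_i nrm (u i).
Proof.
elim/big_ind2: _ => [|x r y q xr yq|i _]; rewrite ?nrm0 //.
by rewrite (le_trans (nrmD _ _)) // lerD.
Qed.

Lemma nrm_sum n (u : nat -> X) : nrm (\sum_(i < n) u i) <= \sum_(i < n) nrm (u i).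
Proof. exact: nrm_big_sum. Qed.

End one_space.

Lemma nrm_scalar_emb r : nrm (r%:F : F^o) = `|r|.
Proof. by apply: (fmorph_inj (emb sc)); rewrite nrmE norm_emb. Qed.

Lemma nrm_rpart (z : F) : `|rpart sc z| <= nrm (z : F^o).
Proof. by rewrite -(emb_le sc) nrmE rpart_le. Qed.

Lemma nrm_ipart (z : F) : `|ipart sc z| <= nrm (z : F^o).
Proof. by rewrite -(emb_le sc) nrmE ipart_le. Qed.

Lemma nrm_parts (z : F) : nrm (z : F^o) <= `|rpart sc z| + `|ipart sc z|.
Proof.
rewrite nrm_le rmorphD -!norm_emb {1}(partsE sc z).
rewrite (le_trans (ler_normD _ _)) // lerD2l normrM.
by rewrite ler_piMl // iunit_le1.
Qed.

End real_norm.

(** * The Hahn-Banach theorem *)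

Section hahn_banach_real.
Context {R : realType} {F : numFieldType} (sc : scalars R F) (X : normedModType F).
Local Notation "r %:F" := (emb sc r).
Local Notation N := (nrm sc).

(** Graphs of partial real-linear functionals dominated by the norm. Such a set is
  single valued: the elements over 0 have values c with both c and -c at most 0. *)
Definition dominated_graph (G : set (X * R)) :=
  (forall t p q, G p -> G q -> G (t%:F *: p.1 + q.1, t * p.2 + q.2)) /\
  (forall p, G p -> p.2 <= N p.1).

(** A value c at v0 is admissible when it lies between all the bounds that the
  elements of G impose from below and from above; these are compatible by the
  triangle inequality. *)
Lemma dominated_graph_extend (G : set (X * R)) v0 : dominated_graph G ->
  G (0, 0) -> exists c, exists2 H, dominated_graph H & G `<=` H /\ H (v0, c).
Proof.
move=> [Glin Gdom] G0.
have sep p q : G p -> G q -> q.2 - N (q.1 - v0) <= N (p.1 + v0) - p.2.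
  move=> Gp Gq.
  have := Gdom _ (Glin 1 _ _ Gp Gq); rewrite /= rmorph1 scale1r mul1r.
  have := nrmD sc (p.1 + v0) (q.1 - v0); rewrite addrACA subrr addr0.
  lra.
pose S := [set q.2 - N (q.1 - v0) | q in G].
have S0 : S !=set0 by exists (0 - N (0 - v0)), (0, 0).
have Sub p : G p -> ubound S (N (p.1 + v0) - p.2).
  by move=> Gp _ [q Gq <-]; exact: sep.
have hS : has_sup S by split => //; exists (N (0 + v0) - 0); exact: (Sub _ G0).
pose c := sup S.
have lec q : G q -> q.2 - N (q.1 - v0) <= c.
  by move=> Gq; apply: sup_upper_bound => //; exists q.
have gec p : G p -> c <= N (p.1 + v0) - p.2.
  by move=> Gp; apply: ge_sup => //; exact: Sub.
have Gsc t p : G p -> G (t%:F *: p.1, t * p.2).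
  by move=> Gp; have := Glin t _ _ Gp G0; rewrite !addr0.
exists c; exists [set p | exists q t, [/\ G q, p.1 = q.1 + t%:F *: v0 & p.2 = q.2 + t * c]].
  split=> [t p q [p' [a [Gp p1 p2]]] [q' [b [Gq q1 q2]]]|p [q [t [Gq -> ->]]]].
    exists (t%:F *: p'.1 + q'.1, t * p'.2 + q'.2), (t * a + b); split => //=.
    - exact: Glin.
    - by rewrite p1 q1 rmorphD rmorphM scalerDr scalerDl -scalerA addrACA.
    - by rewrite p2 q2; ring.
  have [t0|t0|->] := ltrgt0P t; last first.
  - by rewrite mul0r rmorph0 scale0r !addr0; exact: Gdom.
  - have /lec /= := Gsc (- t^-1) _ Gq.
    have -> : (- t^-1)%:F *: q.1 - v0 = (- t^-1)%:F *: (q.1 + t%:F *: v0).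
      by rewrite scalerDr scalerA -rmorphM mulNr mulVf ?lt_eqF // rmorphN1 scaleN1r.
    have s0 : 0 < - t^-1 by rewrite oppr_gt0 invr_lt0.
    rewrite nrmZr (gtr0_norm s0) -mulrBr mulrC -ler_pdivlMr //.
    by rewrite invrN invrK mulrN mulrC; lra.
  - have /gec /= := Gsc t^-1 _ Gq.
    have -> : t^-1%:F *: q.1 + v0 = t^-1%:F *: (q.1 + t%:F *: v0).
      by rewrite scalerDr scalerA -rmorphM mulVf ?gt_eqF // rmorph1 scale1r.
    rewrite nrmZr gtr0_norm ?invr_gt0 //.
    rewrite -mulrBr mulrC ler_pdivlMr // mulrC; lra.
split.
  by move=> p Gp; exists p, 0; rewrite rmorph0 scale0r mul0r !addr0.
by exists (0, 0), 1; rewrite /= rmorph1 scale1r mul1r !add0r.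
Qed.

Lemma hahn_banach_graph x0 : exists G, [/\ dominated_graph G, G (x0, N x0)
  & forall v, exists c, G (v, c)].
Proof.
pose base : set (X * R) := [set (t%:F *: x0, t * N x0) | t in [set: R]].
(* The empty graph is allowed because the union of the empty chain is empty. *)
pose P G := dominated_graph G /\ (G !=set0 -> base `<=` G).
have domb : dominated_graph base.
  split=> [t _ _ [a _ <-] [b _ <-]|_ [a _ <-]] /=.
    exists (t * a + b) => //; apply/pair_equal_spec; split; last by ring.
    by rewrite scalerA -rmorphM -scalerDl -rmorphD.
  by rewrite nrmZr ler_wpM2r ?nrm_ge0 // ler_norm.
have base0 : base (0, 0) by exists 0 => //; rewrite rmorph0 scale0r mul0r.
have [G [[domG Gb] Gmax]] : exists A, P A /\ forall B, A `<` B -> ~ P B.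
  apply: Zorn_bigcup => S SP Stot; split; first split.
  - move=> t p q [A SA Ap] [B SB Bq].
    have [AB|BA] := Stot _ _ SA SB.
      by exists B => //; apply: (SP _ SB).1.1 => //; exact: AB.
    by exists A => //; apply: (SP _ SA).1.1 => //; exact: BA.
  - by move=> p [A SA Ap]; exact: (SP _ SA).1.2.
  - move=> [p [A SA Ap]] q bq; exists A => //; apply: (SP _ SA).2 => //.
    by exists p.
have Gne : G !=set0.
  apply: contrapT => G0; apply: (Gmax base); last by split=> // _ p.
  split=> [p Gp|bG]; first by case: G0; exists p.
  by apply: G0; exists (0, 0); exact: bG.
have bG := Gb Gne.
exists G; split => //.
  by apply: bG; exists 1 => //; rewrite rmorph1 scale1r mul1r.
move=> v; have [c [H domH [GH Hv]]] := dominated_graph_extend v domG (bG _ base0).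
exists c; apply: contrapT => nG; apply: (Gmax H).
  by split => // HG; apply: nG; exact: HG.
by split => // _ p /bG; exact: GH.
Qed.

Lemma hahn_banach_real x0 : exists u : X -> R,
  [/\ forall t x y, u (t%:F *: x + y) = t * u x + u y,
      forall x, u x <= N x & u x0 = N x0].
Proof.
have [G [[Glin Gdom] Gx0 Gtot]] := hahn_banach_graph x0.
have Guniq v c c' : G (v, c) -> G (v, c') -> c = c'.
  move=> Gc Gc'; apply/eqP; rewrite eq_le.
  have := Gdom _ (Glin (-1) _ _ Gc Gc').
  have := Gdom _ (Glin (-1) _ _ Gc' Gc).
  by rewrite /= rmorphN1 scaleN1r addNr nrm0; lra.
have [u Gu] := choice Gtot.
exists u; split.
- by move=> t x y; apply: (Guniq _ _ _ (Gu _)); exact: (Glin t _ _ (Gu x) (Gu y)).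
- by move=> x; exact: (Gdom _ (Gu x)).
- exact: (Guniq _ _ _ (Gu _) Gx0).
Qed.

End hahn_banach_real.

(** Over the complex scalars the functional is recovered from its real part u
  as [u v - i u (i v)]; with [iunit = 0] the same formula is u itself. *)
Lemma hahn_banach (R : realType) (F : numFieldType) (sc : scalars R F)
    (X : normedModType F) (x0 : X) : exists phi : {linear X -> F^o},
  (forall x, nrm sc (phi x) <= nrm sc x) /\ phi x0 = emb sc (nrm sc x0).
Proof.
have [u [ulin udom ux0]] := hahn_banach_real sc x0.
have uD x y : u (x + y) = u x + u y.
  by have := ulin 1 x y; rewrite rmorph1 scale1r mul1r.
have u0 : u 0 = 0 by have := uD 0 0; rewrite addr0; lra.
have uZ t x : u (emb sc t *: x) = t * u x by have := ulin t x 0; rewrite u0 !addr0.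
have uN x : u (- x) = - u x by have := uZ (-1) x; rewrite rmorphN1 scaleN1r mulN1r.
pose j := iunit sc.
pose phi (x : X) : F := emb sc (u x) - j * emb sc (u (j *: x)).
have phiD x y : phi (x + y) = phi x + phi y.
  by rewrite /phi scalerDr !uD !rmorphD mulrDr opprD addrACA.
have phiZr t x : phi (emb sc t *: x) = emb sc t * phi x.
  by rewrite /phi scalerA [j * emb sc t]mulrC -scalerA !uZ !rmorphM mulrBr [j * (_ * _)]mulrCA.
have phiZj x : phi (j *: x) = j * phi x.
  rewrite /phi scalerA; case: (iunit_cases sc) => jj; last first.
    rewrite jj scaleN1r uN rmorphN; have : j * j = -1 := jj.
    by move=> jj'; rewrite mulrBr mulrA jj'; ring.
  by rewrite /j jj !mul0r scale0r u0 rmorph0 subrr.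
have phiZ (a : F) x : phi (a *: x) = a * phi x.
  rewrite (partsE sc a) scalerDl phiD phiZr -scalerA phiZj phiZr.
  by rewrite mulrDl mulrA.
have phi_lin : linear (phi : X -> F^o) by move=> a x y; rewrite phiD phiZ.
have rphi x : rpart sc (phi x) = u x.
  rewrite /phi -mulrN -rmorphN rpartD rpart_emb rpart_iunit addr0 //.
pose phiL : {linear X -> F^o} := HB.pack (phi : X -> F^o) (GRing.isLinear.Build _ _ _ _ _ phi_lin).
have phi_le x : nrm sc (phi x) <= nrm sc x.
  have [->|px0] := eqVneq (phi x) 0; first by rewrite nrm0 nrm_ge0.
  pose w : F := `|phi x| / phi x.
  have w1 : `|w| = 1 by rewrite normrM normfV normr_id mulfV ?normr_eq0.
  have -> : nrm sc (phi x) = u (w *: x).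
    by rewrite -rphi phiZ /w divfK.
  rewrite (le_trans (udom _)) // nrm_le normrZ w1 mul1r nrmE //.
(* The norm bound forces |phi x0| = N x0; a rotation makes the value real. *)
have nx0 : `|phi x0| = emb sc (nrm sc x0).
  rewrite -(nrmE sc (phi x0 : F^o)); congr (emb sc _); apply/eqP; rewrite eq_le phi_le /=.
  by rewrite -[leLHS]ux0 -rphi (le_trans (ler_norm _) (nrm_rpart _ _)).
have [px0|px0] := eqVneq (phi x0) 0.
  by exists phiL; split => //=; rewrite px0 -nx0 px0 normr0.
pose w : F := `|phi x0| / phi x0.
have w1 : `|w| = 1 by rewrite normrM normfV normr_id mulfV ?normr_eq0.
have wphi_lin : linear (fun x => w * phi x : F^o).
  by move=> a x y; rewrite phi_lin mulrDr [w * _]mulrCA.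
pose wphiL : {linear X -> F^o} :=
  HB.pack (fun x => w * phi x : F^o) (GRing.isLinear.Build _ _ _ _ _ wphi_lin).
exists wphiL; split=> [x|] /=; last by rewrite /w divfK.
by rewrite nrm_le normrM w1 mul1r -(nrmE sc (phi x : F^o)) emb_le.
Qed.

(** * Sequences, closed subspaces and dimension *)

Section closed_sets.
Context {R : realType} {F : numFieldType} (sc : scalars R F).
Local Notation "r %:F" := (emb sc r).
Local Notation N := (nrm sc).

Lemma closed_nrmP (X : normedModType F) (Y : set X) : closed Y <->
  forall x, (forall e, 0 < e -> exists2 y, Y y & N (x - y) < e) -> Y x.
Proof.
split=> [cY x xY|YP x Yx].
  apply: cY => B /nbhs_ballP[e /= /(emb_gt0_ex sc)[r r0 ->]] rB.
  have [y Yy xy] := xY _ r0; exists y; split => //; apply: rB.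
  by rewrite -ball_normE /= -nrm_lt.
apply: YP => e e0.
have e0' : 0 < e%:F by rewrite emb_gt0.
have [y [Yy]] := Yx _ (nbhsx_ballx x _ e0').
by rewrite -ball_normE /= -nrm_lt => xy; exists y.
Qed.

Lemma bounded_continuous (X Z : normedModType F) (f : {linear X -> Z}) (C : R) :
  (forall x, N (f x) <= C * N x) -> continuous f.
Proof.
move=> fC; apply: bounded_linear_continuous; apply/linear_boundedP.
exists `|C|%:F; split; first by rewrite ger0_real // emb_ge0.
move=> r Cr x; rewrite -(nrmE sc (f x)) -(nrmE sc x).
apply: (@le_trans _ _ (`|C| * N x)%:F).
  by rewrite emb_le (le_trans (fC x)) // ler_wpM2r ?nrm_ge0 // ler_norm.
by rewrite rmorphM ler_wpM2r ?emb_ge0 ?nrm_ge0 // ltW.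
Qed.

Lemma continuous_bounded (X Z : normedModType F) (f : {linear X -> Z}) :
  continuous f -> exists2 C, 0 < C & forall x, N (f x) <= C * N x.
Proof.
move=> /linear_bounded_continuous/linear_boundedP/pinfty_ex_gt0[C C0 fC].
have [r r0 Cr] := emb_gt0_ex sc C0; exists r => // x.
by rewrite nrm_le rmorphM nrmE -Cr.
Qed.

Definition tends (X : normedModType F) (u : nat -> X) (l : X) :=
  forall e, 0 < e -> exists n0, forall n, (n0 <= n)%N -> N (u n - l) < e.

Lemma cauchy_tends (X : completeNormedModType F) (u : nat -> X) :
  (forall e, 0 < e -> exists n0, forall m n, (n0 <= m)%N -> (m <= n)%N ->
     N (u n - u m) < e) ->
  exists l, tends u l.
Proof.
move=> uC; have /cauchy_cvg cu : cauchy (u @ \oo).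
  apply/cauchy_ballP => e /(emb_gt0_ex sc)[r r0 ->].
  have [n0 Hn0] := uC _ r0.
  exists (u @` [set n | (n0 <= n)%N], u @` [set n | (n0 <= n)%N]) => /=.
    by split; exists n0 => // n /= n0n; exists n.
  move=> _ [[m /= Hm <-] [n /= Hn <-]]; rewrite -ball_normE /= -nrm_lt.
  have [mn|/ltnW nm] := leqP m n; last exact: Hn0.
  by rewrite nrm_distC; exact: Hn0.
have /cvg_ex[l /cvgrPdist_lt ul] := cu.
exists l => e e0.
have e0' : 0 < e%:F by rewrite emb_gt0.
have [n0 _ Hn0] := ul _ e0'.
by exists n0 => n /Hn0 /=; rewrite -nrm_lt nrm_distC.
Qed.

Lemma ltr_eps (x : R) : (forall e, 0 < e -> x < e) -> x <= 0.
Proof.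
by move=> H; rewrite leNgt; apply/negP => x0; have := H _ x0; rewrite ltxx.
Qed.

Lemma tends_unique (X : normedModType F) (u : nat -> X) l l' :
  tends u l -> tends u l' -> l = l'.
Proof.
move=> ul ul'; apply/eqP; rewrite -subr_eq0; apply/eqP/(@nrm_eq0 _ _ sc).
apply/eqP; rewrite eq_le nrm_ge0 andbT; apply: ltr_eps => e e0.
have e20 : 0 < e / 2 by lra.
have [n Hn] := ul _ e20; have [m Hm] := ul' _ e20.
have := Hn _ (leq_maxl n m); have := Hm _ (leq_maxr n m).
have := nrm_triangle sc (u (maxn n m)) l l'.
by rewrite (nrm_distC sc l (u _)); lra.
Qed.

Lemma tends_lin (X : normedModType F) (u v : nat -> X) l k (a : F) :
  tends u l -> tends v k -> tends (fun n => a *: u n + v n) (a *: l + k).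
Proof.
move=> ul vk e e0; set c := N (a : F^o) + 1.
have c0 : 0 < c by rewrite /c ltr_pwDr // nrm_ge0.
have e20 : 0 < e / 2 by lra.
have ec0 : 0 < e / 2 / c by rewrite divr_gt0.
have [n Hn] := ul _ ec0; have [m Hm] := vk _ e20.
exists (maxn n m) => p; rewrite geq_max => /andP[/Hn np /Hm mp].
have -> : a *: u p + v p - (a *: l + k) = a *: (u p - l) + (v p - k).
  by rewrite scalerBr opprD addrACA.
rewrite (le_lt_trans (nrmD _ _ _)) // nrmZ.
have : N (a : F^o) * N (u p - l) <= c * N (u p - l).
  by rewrite ler_wpM2r ?nrm_ge0 // /c lerDl.
move: np; rewrite ltr_pdivlMr // mulrC; lra.
Qed.

Lemma tends_bounded_map (X Z : normedModType F) (f : {linear X -> Z}) C u l :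
  (forall x, N (f x) <= C * N x) -> tends u l -> tends (fun n => f (u n)) (f l).
Proof.
move=> fC ul e e0; set c := `|C| + 1.
have c0 : 0 < c by rewrite /c ltr_pwDr.
have ec0 : 0 < e / c by rewrite divr_gt0.
have [n Hn] := ul _ ec0; exists n => m /Hn.
rewrite -linearB ltr_pdivlMr // mulrC; apply: le_lt_trans.
rewrite (le_trans (fC _)) // ler_wpM2r ?nrm_ge0 // /c.
by rewrite (le_trans (ler_norm _)) // lerDl.
Qed.

Lemma tends_le (X : normedModType F) (u : nat -> X) l C :
  tends u l -> (exists n0, forall n, (n0 <= n)%N -> N (u n) <= C) -> N l <= C.
Proof.
move=> ul [m uC]; rewrite -subr_le0; apply: ltr_eps => e e0.
have [n Hn] := ul _ e0.
have := Hn _ (leq_maxl n m); have := uC _ (leq_maxr n m).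
have := nrm_le_dist sc l (u (maxn n m)).
by rewrite (nrm_distC sc l (u _)); lra.
Qed.

Lemma tends_closed (X : normedModType F) (Y : set X) u l :
  closed Y -> tends u l -> (forall n, Y (u n)) -> Y l.
Proof.
move=> /closed_nrmP cY ul Yu; apply: cY => e /ul[n Hn].
by exists (u n) => //; rewrite nrm_distC; exact: Hn.
Qed.

Lemma half_exp_small (e : R) : 0 < e -> exists n0, forall n, (n0 <= n)%N -> 2^-1 ^+ n < e.
Proof.
move=> e0; have h : `|2^-1 : R| < 1 by rewrite ger0_norm; lra.
have /cvgrPdist_lt/(_ _ e0)[n0 _ H] := cvg_expr h.
exists n0 => n /H /=; rewrite sub0r normrN ger0_norm // exprn_ge0 //; lra.
Qed.

Lemma closure_tends (X : normedModType F) (Y : set X) x :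
  (forall e, 0 < e -> exists2 y, Y y & N (x - y) < e) ->
  exists2 u : nat -> X, (forall n, Y (u n)) & tends u x.
Proof.
move=> xY; have H n : exists y, Y y /\ N (x - y) < 2^-1 ^+ n.
  have h : 0 < (2^-1 : R) ^+ n by rewrite exprn_gt0 //; lra.
  by have [y Yy xy] := xY _ h; exists y.
have [u Hu] := choice H; exists u => [n|e e0]; first exact: (Hu n).1.
have [n0 Hn0] := half_exp_small e0; exists n0 => n n0n.
by rewrite nrm_distC (lt_trans (Hu n).2) // Hn0.
Qed.

End closed_sets.

Section subspaces.
Context {F : numFieldType} {X : normedModType F}.
Implicit Types Y Z : set X.

Lemma subspaceZ Y a u : closed_subspace Y -> Y u -> Y (a *: u).
Proof. by move=> [Y0 Yl _] Yu; rewrite -[_ *: _]addr0; exact: Yl. Qed.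

Lemma subspaceD Y u v : closed_subspace Y -> Y u -> Y v -> Y (u + v).
Proof. by move=> [Y0 Yl _] Yu Yv; rewrite -[u]scale1r; exact: Yl. Qed.

Lemma subspaceB Y u v : closed_subspace Y -> Y u -> Y v -> Y (u - v).
Proof.
move=> cY Yu Yv; apply: subspaceD => //.
by rewrite -scaleN1r; exact: subspaceZ.
Qed.

Lemma subspace_sum Y n (u : nat -> X) : closed_subspace Y ->
  (forall k, (k < n)%N -> Y (u k)) -> Y (\sum_(k < n) u k).
Proof.
move=> cY; elim: n => [|n IH] Yu; first by rewrite big_ord0; case: cY.
rewrite big_ord_recr /=; apply: subspaceD => //; last exact: Yu.
by apply: IH => k kn; apply: Yu; exact: ltnW.
Qed.

Lemma infdim_nonzero Y : Y 0 -> infinite_dimensional Y -> exists2 y, Y y & y <> 0.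
Proof.
move=> Y0 Yinf; apply: contrapT => nY; apply: Yinf.
exists 0%N, (fun _ => 0); apply/seteqP; split=> [y Yy|_ [c _ <-]]; last by rewrite big_ord0.
exists (fun _ => 0) => //; rewrite big_ord0; apply: contrapT => y0.
by apply: nY; exists y => // /esym.
Qed.

(** A functional cuts the dimension by at most one. *)
Lemma infdim_ker Y (phi : {linear X -> F^o}) :
  (forall a u v, Y u -> Y v -> Y (a *: u + v)) ->
  infinite_dimensional Y -> infinite_dimensional (Y `&` [set x | phi x = 0]).
Proof.
move=> Yl Yinf [n [e He]]; apply: Yinf.
have [[v Yv pv]|Yphi] := pselect (exists2 v, Y v & phi v <> 0); last first.
  exists n, e; rewrite -He; apply/seteqP; split=> [y Yy|y []//]; split => //.
  by apply: contrapT => py; apply: Yphi; exists y.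
pose e' i := if unlift ord0 i is Some j then e j else v.
have Ye j : Y (e j).
  suff [] : (Y `&` [set x | phi x = 0]) (e j) by [].
  rewrite He; exists (fun i => (i == j)%:R) => //.
  rewrite (bigD1 j) //= eqxx scale1r big1 ?addr0 // => i /negbTE ->.
  by rewrite scale0r.
have Y0 : Y 0 by rewrite -(addNr v) -scaleN1r; exact: Yl.
have Ysum (c : 'I_n -> F) : Y (\sum_i c i *: e i).
  apply: (big_ind Y) => //; last by move=> i _; rewrite -[_ *: _]addr0; exact: Yl.
  by move=> x y Yx Yy; rewrite -[x]scale1r; exact: Yl.
exists n.+1, e'; apply/seteqP; split=> [y Yy|_ [c _ <-]].
  have Yyv : (Y `&` [set x | phi x = 0]) (- (phi y / phi v) *: v + y).
    split; first exact: Yl.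
    rewrite /= linearD linearZ /= /GRing.scale /= mulNr divfK ?addNr //; exact/eqP.
  move: Yyv; rewrite He => -[c _ Hc].
  exists (fun i => if unlift ord0 i is Some j then c j else phi y / phi v) => //.
  rewrite big_ord_recl /e' unlift_none.
  under eq_bigr do rewrite liftK.
  by rewrite Hc scaleNr addNKr.
rewrite big_ord_recl /e' unlift_none; apply: Yl => //.
under eq_bigr do rewrite liftK.
exact: Ysum.
Qed.

Lemma infdim_kers Y (phi : nat -> {linear X -> F^o}) n :
  (forall a u v, Y u -> Y v -> Y (a *: u + v)) -> infinite_dimensional Y ->
  infinite_dimensional (Y `&` [set x | forall k, (k < n)%N -> phi k x = 0]).
Proof.
move=> Yl Yinf; elim: n => [|n IH].
  by rewrite (_ : _ `&` _ = Y) //; apply/seteqP; split=> [y []|].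
have -> : Y `&` [set x | forall k, (k < n.+1)%N -> phi k x = 0] =
    (Y `&` [set x | forall k, (k < n)%N -> phi k x = 0]) `&` [set x | phi n x = 0].
  apply/seteqP; split=> [y [Yy yn]|y [[Yy yn] py]].
    by split; [split=> // k kn; apply: yn; exact: ltnW|exact: yn].
  by split=> // k; rewrite ltnS leq_eqVlt => /predU1P[->|/yn].
apply: infdim_ker => // a u v [Yu un] [Yv vn]; split; first exact: Yl.
by move=> k kn; rewrite linearD linearZ /= un // vn // scaler0 addr0.
Qed.

Lemma closed_subspace_kers (R : realType) (sc : scalars R F) Y
    (phi : nat -> {linear X -> F^o}) n :
  closed_subspace Y -> (forall k, exists C, forall x, nrm sc (phi k x) <= C * nrm sc x) ->
  closed_subspace (Y `&` [set x | forall k, (k < n)%N -> phi k x = 0]).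
Proof.
move=> [Y0 Yl cY] phiC; split.
- by split => // k _; rewrite linear0.
- move=> a u v [Yu un] [Yv vn]; split; first exact: Yl.
  by move=> k kn; rewrite linearD linearZ /= un // vn // scaler0 addr0.
apply/(closed_nrmP sc) => x /closure_tends[u uY ux]; split.
  by apply: tends_closed ux _ => // k; case: (uY k).
move=> k kn; have [C HC] := phiC k.
apply: tends_unique (tends_bounded_map HC ux) _ => e e0; exists 0%N => m _.
by rewrite (uY m).2 // subrr nrm0.
Qed.

Definition independent (y : nat -> X) := forall n (a : nat -> F),
  \sum_(k < n) a k *: y k = 0 -> forall k, (k < n)%N -> a k = 0.

(** More than n vectors in the span of n vectors have a linear relation, which a
  nonzero vector in the kernel of their coordinate matrix provides. *)
Lemma infdim_independent Y (y : nat -> X) : (forall k, Y (y k)) -> independent y ->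
  infinite_dimensional Y.
Proof.
move=> Yy yfree [n [e He]].
have H k : exists c : 'I_n -> F, \sum_i c i *: e i = y k.
  by have := Yy k; rewrite He => -[c _ <-]; exists c.
have [c Hc] := choice H.
pose M : 'M[F]_(n.+1, n) := \matrix_(k, i) c k i.
have : kermx M != 0.
  rewrite kermx_eq0 /row_free; apply/negP => /eqP rM.
  by have := rank_leq_col M; rewrite rM ltnn.
move=> /rowV0Pn[w /sub_kermxP wM w0].
have : \sum_(k < n.+1) (w 0 (inord k)) *: y k = 0.
  under eq_bigr => k _ do rewrite inord_val -Hc scaler_sumr.
  rewrite exchange_big /= big1 // => i _.
  under eq_bigr => k _ do rewrite scalerA.
  rewrite -scaler_suml.
  have /matrixP/(_ 0 i) := wM; rewrite !mxE => wM0.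
  rewrite (_ : \sum_(_ < _) _ = 0) ?scale0r // -[RHS]wM0.
  by apply: eq_bigr => k _; rewrite !mxE.
move=> /(yfree n.+1 (fun k => w 0 (inord k))) w00.
move/eqP: w0; apply; apply/rowP => k; rewrite mxE.
by rewrite -[k]inord_val; exact: (w00 k).
Qed.

End subspaces.

Section closed_span.
Context {R : realType} {F : numFieldType} (sc : scalars R F).
Context {X : normedModType F}.
Local Notation N := (nrm sc).

Definition closed_span (y : nat -> X) : set X := [set x | forall e, 0 < e ->
  exists n (a : nat -> F), N (x - \sum_(k < n) a k *: y k) < e].

Lemma sum_pad (a : nat -> F) (y : nat -> X) n m : (n <= m)%N ->
  \sum_(k < n) a k *: y k = \sum_(k < m) (if (k < n)%N then a k else 0) *: y k.
Proof.
move=> nm; rewrite (big_ord_widen _ (fun k => a k *: y k) nm) big_mkcond /=.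
by apply: eq_bigr => k _; case: ifP => // _; rewrite scale0r.
Qed.

Lemma closed_span_sum y n (a : nat -> F) : closed_span y (\sum_(k < n) a k *: y k).
Proof. by move=> e e0; exists n, a; rewrite subrr nrm0. Qed.

Lemma closed_span_gen y k : closed_span y (y k).
Proof.
have := closed_span_sum y k.+1 (fun i => (i == k)%:R).
rewrite big_ord_recr /= eqxx scale1r big1 ?add0r // => i _.
by rewrite ltn_eqF // scale0r.
Qed.

Lemma closed_span_subspace y : closed_subspace (closed_span y).
Proof.
split.
- by move=> e e0; exists 0%N, (fun _ => 0); rewrite big_ord0 subrr nrm0.
- move=> c u v Yu Yv e e0; set d := N (c : F^o) + 1.
  have d0 : 0 < d by rewrite /d ltr_pwDr // nrm_ge0.
  have e20 : 0 < e / 2 by lra.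
  have ed0 : 0 < e / 2 / d by rewrite divr_gt0.
  have [n [a Ha]] := Yu _ ed0; have [m [b Hb]] := Yv _ e20.
  pose a' k := if (k < n)%N then a k else 0.
  pose b' k := if (k < m)%N then b k else 0.
  rewrite (sum_pad a y (leq_maxl n m)) -[X in N (_ - X)]/(\sum_(k < maxn n m) a' k *: y k) in Ha.
  rewrite (sum_pad b y (leq_maxr n m)) -[X in N (_ - X)]/(\sum_(k < maxn n m) b' k *: y k) in Hb.
  exists (maxn n m), (fun k => c * a' k + b' k).
  under eq_bigr do rewrite scalerDl -scalerA.
  rewrite big_split /= -scaler_sumr opprD addrACA -scalerBr.
  rewrite (le_lt_trans (nrmD _ _ _)) // nrmZ.
  have : N (c : F^o) * N (u - \sum_(k < maxn n m) a' k *: y k) <=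
      d * N (u - \sum_(k < maxn n m) a' k *: y k).
    by rewrite ler_wpM2r ?nrm_ge0 // /d lerDl.
  by move: Ha; rewrite ltr_pdivlMr // mulrC; lra.
- apply/(closed_nrmP sc) => x xY e e0; have e20 : 0 < e / 2 by lra.
  have [z Yz xz] := xY _ e20; have [n [a Ha]] := Yz _ e20.
  exists n, a; apply: le_lt_trans (nrm_triangle _ z _ _) _; lra.
Qed.

Lemma closed_span_min y Y : closed_subspace Y -> (forall k, Y (y k)) ->
  closed_span y `<=` Y.
Proof.
move=> cY Yy x xy; have [_ _ /(closed_nrmP sc) cl] := cY; apply: cl => e /xy[n [a xa]].
exists (\sum_(k < n) a k *: y k) => //.
apply: (subspace_sum (u := fun k => a k *: y k)) => // k _.
exact: subspaceZ.
Qed.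

Lemma closed_span_le (y : nat -> X) (Z1 Z2 : normedModType F) (f : {linear X -> Z1})
    (g : {linear X -> Z2}) Cf Cg :
  (forall x, N (f x) <= Cf * N x) -> (forall x, N (g x) <= Cg * N x) ->
  (forall n (a : nat -> F), N (f (\sum_(k < n) a k *: y k)) <=
     N (g (\sum_(k < n) a k *: y k))) ->
  forall x, closed_span y x -> N (f x) <= N (g x).
Proof.
move=> fC gC fg x xy; rewrite -subr_le0; apply: ltr_eps => e e0.
set c := `|Cf| + `|Cg| + 1.
have c0 : 0 < c by rewrite /c ltr_pwDr.
have ec0 : 0 < e / c by rewrite divr_gt0.
have [n [a]] := xy _ ec0; set s := \sum_(k < n) _ => xs.
have := fg n a; rewrite -/s => fgs.
have := nrm_le_dist sc (f x) (f s); have := nrm_le_dist sc (g s) (g x).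
rewrite (nrm_distC sc (g s)) -!linearB.
have := fC (x - s); have := gC (x - s).
have : Cf * N (x - s) + Cg * N (x - s) < e.
  move: xs; rewrite ltr_pdivlMr // mulrC; apply: le_lt_trans.
  rewrite -mulrDl ler_wpM2r ?nrm_ge0 // /c.
  by have := ler_norm Cf; have := ler_norm Cg; lra.
lra.
Qed.

End closed_span.

(** * Producing complemented subspaces *)

Section complemented_subspaces.
Context {R : realType} {F : numFieldType} (sc : scalars R F).
Local Notation "r %:F" := (emb sc r).
Local Notation N := (nrm sc).

Lemma complemented_intro (E : normedModType F) (Z : set E) (p : E -> E) (C : R) :
  linear p -> (forall x, N (p x) <= C * N x) -> (forall x, Z (p x)) ->
  (forall z, Z z -> p z = z) -> complemented Z.
Proof.
move=> plin pC pZ pid.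
pose P : {linear E -> E} := HB.pack p (GRing.isLinear.Build _ _ _ _ _ plin).
exists P; split.
- exact: (@bounded_continuous _ _ sc _ _ P C pC).
- by move=> x; rewrite /= pid.
- by apply/seteqP; split=> [_ [x _ <-]|z Zz]; [exact: pZ|exists z => //; exact: pid].
Qed.

(** Subprojectivity pulls back along an operator T at every subspace on which T
  is bounded below: if P projects onto a subspace of T(Y), then the inverse of T
  on Y, composed with P and T, projects onto a subspace of Y. *)
Lemma complemented_pullback (E : completeNormedModType F) (G : normedModType F)
    (T : {linear E -> G}) (C c : R) (Y : set E) :
  (forall x, N (T x) <= C * N x) -> closed_subspace Y -> infinite_dimensional Y ->
  0 < c -> (forall y, Y y -> N y <= c * N (T y)) -> subprojective G ->
  exists Z, [/\ Z `<=` Y, closed_subspace Z, infinite_dimensional Z & complemented Z].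
Proof.
move=> TC cY Yinf c0 Tc spG.
have Tinj y y' : Y y -> Y y' -> T y = T y' -> y = y'.
  move=> Yy Yy' TT; apply/eqP; rewrite -subr_eq0; apply/eqP/(@nrm_eq0 _ _ sc).
  apply/eqP; rewrite eq_le nrm_ge0 andbT.
  by have := Tc _ (subspaceB cY Yy Yy'); rewrite linearB TT subrr nrm0 mulr0.
have [Y0 Yl clY] := cY.
have cW : closed_subspace (T @` Y).
  split.
  - by exists 0 => //; rewrite linear0.
  - move=> a _ _ [u Yu <-] [v Yv <-]; exists (a *: u + v); first exact: Yl.
    by rewrite linearD linearZ.
  - apply/(closed_nrmP sc) => x /closure_tends[w wW wx].
    have H n : exists y, Y y /\ T y = w n by have [y Yy <-] := wW n; exists y.
    have [u Hu] := choice H.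
    have [e e0|l ul] := @cauchy_tends _ _ sc _ u.
      have ec0 : 0 < e / c / 2 by rewrite !divr_gt0.
      have [n0 Hn0] := wx _ ec0; exists n0 => m n n0m mn.
      rewrite (le_lt_trans (Tc _ (subspaceB cY (Hu n).1 (Hu m).1))) //.
      rewrite linearB (Hu n).2 (Hu m).2 mulrC -ltr_pdivlMr //.
      have := nrm_triangle sc x (w n) (w m); rewrite (nrm_distC sc x (w m)).
      have := Hn0 _ n0m; have := Hn0 _ (leq_trans n0m mn); lra.
    exists l; first by apply: tends_closed ul _ => // n; exact: (Hu n).1.
    apply: tends_unique (tends_bounded_map TC ul) _ => e /wx[n0 Hn0].
    by exists n0 => n /Hn0; rewrite (Hu n).2.
have infW : infinite_dimensional (T @` Y).
  move=> [n [e He]]; apply: Yinf.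
  have H i : exists v, Y v /\ T v = e i.
    suff [v Yv <-] : (T @` Y) (e i) by exists v.
    rewrite He; exists (fun j => (j == i)%:R) => //.
    rewrite (bigD1 i) //= eqxx scale1r big1 ?addr0 // => j /negbTE ->.
    by rewrite scale0r.
  have [v Hv] := choice H.
  have Ysum (a : 'I_n -> F) : Y (\sum_i a i *: v i).
    apply: (big_ind Y) => //; first by move=> x y; exact: subspaceD.
    by move=> i _; apply: subspaceZ => //; exact: (Hv i).1.
  exists n, v; apply/seteqP; split=> [y Yy|_ [a _ <-]]; last exact: Ysum.
  have : (T @` Y) (T y) by exists y.
  rewrite He => -[a _ Ha]; exists a => //; apply: Tinj => //.
  by rewrite -Ha linear_sum; apply: eq_bigr => i _; rewrite linearZ /= (Hv i).2.
have [Z' [Z'W cZ' infZ' [P' [P'c P'id P'Z]]]] := spG _ cW infW.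
have [CP CP0 P'C] := continuous_bounded sc P'c.
have P'W x : Z' (P' (T x)) by rewrite -P'Z; exists (T x).
have [Z'0 Z'l clZ'] := cZ'.
exists (Y `&` [set y | Z' (T y)]); split.
- by move=> y [].
- split.
  + by split => //=; rewrite linear0.
  + move=> a u v [Yu Zu] [Yv Zv]; split; first exact: Yl.
    by rewrite /= linearD linearZ; exact: Z'l.
  + apply/(closed_nrmP sc) => x /closure_tends[u uY ux]; split.
      by apply: tends_closed ux _ => // n; case: (uY n).
    by apply: tends_closed clZ' (tends_bounded_map TC ux) _ => n; case: (uY n).
- move=> [n [e He]]; apply: infZ'; exists n, (T \o e).
  apply/seteqP; split=> [z Z'z|_ [a _ <-]].
    have [y Yy yz] := Z'W _ Z'z.
    have : (Y `&` [set y | Z' (T y)]) y by split => //=; rewrite yz.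
    rewrite He => -[a _ Ha]; exists a => //; rewrite -yz -Ha linear_sum.
    by apply: eq_bigr => i _; rewrite linearZ.
  have -> : \sum_i a i *: (T \o e) i = T (\sum_i a i *: e i).
    by rewrite linear_sum; apply: eq_bigr => i _; rewrite linearZ.
  suff [] : (Y `&` [set y | Z' (T y)]) (\sum_i a i *: e i) by [].
  by rewrite He; exists a.
have H x : exists y, Y y /\ T y = P' (T x).
  by have [y Yy <-] := Z'W _ (P'W x); exists y.
have [p Hp] := choice H.
apply: (@complemented_intro _ _ p (c * (CP * C))).
- move=> a x y; apply: Tinj; first exact: (Hp _).1.
    by apply: Yl; exact: (Hp _).1.
  by rewrite linearD linearZ /= !(Hp _).2 !linearD !linearZ.
- move=> x; rewrite (le_trans (Tc _ (Hp x).1)) // (Hp x).2 -!mulrA ler_pM2l //.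
  by rewrite (le_trans (P'C _)) // ler_pM2l.
- by move=> x; split; [exact: (Hp x).1|rewrite /= (Hp x).2].
- move=> z [Yz Z'z]; apply: Tinj => //; first exact: (Hp z).1.
  by rewrite (Hp z).2; move: Z'z; rewrite /= -P'Z => -[w _ <-]; rewrite P'id.
Qed.

(** An operator into Z that is within 1/2 of the identity on Z can be corrected to
  a projection: the iterates [x - (1 - Q)^n x] stay in Z and converge to it. *)
Lemma complemented_near_projection (E : completeNormedModType F) (Z : set E)
    (Q : {linear E -> E}) (C : R) :
  closed_subspace Z -> (forall x, N (Q x) <= C * N x) -> (forall x, Z (Q x)) ->
  (forall z, Z z -> N (Q z - z) <= 2^-1 * N z) -> complemented Z.
Proof.
move=> cZ QC QZ Qnear; have [Z0 Zl clZ] := cZ.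
pose g n x := iter n (fun v => v - Q v) x.
have gS n x : g n.+1 x = g n x - Q (g n x) by [].
have glin n a x y : g n (a *: x + y) = a *: g n x + g n y.
  elim: n => // n IH; rewrite !gS IH linearD linearZ /=.
  by rewrite scalerBr opprD addrACA.
have Qg n x : N (Q (g n x)) <= 2^-1 ^+ n * N (Q x).
  elim: n => [|n IH]; first by rewrite expr0 mul1r.
  rewrite gS linearB /= nrm_distC (le_trans (Qnear _ (QZ _))) // exprS -mulrA.
  by rewrite ler_pM2l //; lra.
pose s n x := x - g n x.
have sS n x : s n.+1 x = s n x + Q (g n x).
  by rewrite /s gS opprB addrA addrAC.
have sZ n x : Z (s n x).
  elim: n => [|n IH]; first by rewrite /s subrr.
  by rewrite sS; exact: subspaceD.
have scauchy x m n : (m <= n)%N ->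
    N (s n x - s m x) <= 2 * (2^-1 ^+ m - 2^-1 ^+ n) * N (Q x).
  elim: n => [|n IH].
    by rewrite leqn0 => /eqP ->; rewrite subrr nrm0 subrr mulr0 mul0r.
  rewrite leq_eqVlt => /predU1P[<-|]; first by rewrite !subrr nrm0 mulr0 mul0r.
  rewrite ltnS => /IH smn; rewrite sS addrAC (le_trans (nrmD _ _ _)) //.
  have := Qg n x; rewrite exprS; move: (2^-1 ^+ n) smn => q; nra.
have H x : exists l, tends sc (s ^~ x) l.
  apply: cauchy_tends => e e0.
  have k0 : 0 < 2 * N (Q x) + 1 by have := nrm_ge0 sc (Q x); lra.
  have ek0 : 0 < e / (2 * N (Q x) + 1) by rewrite divr_gt0.
  have [n0 Hn0] := half_exp_small ek0; exists n0 => m n n0m mn.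
  apply: le_lt_trans (scauchy x m n mn) _.
  have := Hn0 _ n0m; rewrite ltr_pdivlMr //.
  have : 0 < (2^-1 : R) ^+ n by rewrite exprn_gt0 //; lra.
  have : 0 < (2^-1 : R) ^+ m by rewrite exprn_gt0 //; lra.
  have := nrm_ge0 sc (Q x).
  move: (2^-1 ^+ n) (2^-1 ^+ m) => q r; nra.
have [p Hp] := choice H.
apply: (@complemented_intro _ _ p (2 * C)).
- move=> a x y; apply: tends_unique (Hp _) _ => e e0.
  have [n0 Hn0] := tends_lin a (Hp x) (Hp y) e0.
  exists n0 => n /Hn0; congr (_ < _); congr (N (_ - _)).
  by rewrite /s glin scalerBr opprD addrACA.
- move=> x; apply: (tends_le (Hp x)); exists 0%N => n _.
  have := scauchy x 0%N n (leq0n n); rewrite {2}/s subrr subr0 expr0.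
  have := QC x; have := nrm_ge0 sc (Q x).
  have : 0 < (2^-1 : R) ^+ n by rewrite exprn_gt0 //; lra.
  move: (2^-1 ^+ n) => q; nra.
- by move=> x; apply: tends_closed (Hp x) _.
- move=> z Zz; apply: tends_unique (Hp z) _ => e e0.
  have gZ n : Z (g n z) /\ N (g n z) <= 2^-1 ^+ n * N z.
    elim: n => [|n [Zg IH]]; first by rewrite expr0 mul1r.
    rewrite gS; split; first exact: subspaceB.
    rewrite nrm_distC (le_trans (Qnear _ Zg)) // exprS -mulrA ler_pM2l //; lra.
  have k0 : 0 < N z + 1 by have := nrm_ge0 sc z; lra.
  have ek0 : 0 < e / (N z + 1) by rewrite divr_gt0.
  have [n0 Hn0] := half_exp_small ek0; exists n0 => n /Hn0.
  rewrite ltr_pdivlMr // /s addrAC subrr sub0r nrmN.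
  have : 0 < (2^-1 : R) ^+ n by rewrite exprn_gt0 //; lra.
  have [_] := gZ n; move: (2^-1 ^+ n) => q; nra.
Qed.

End complemented_subspaces.

Section sequences_of_vectors.
Context {R : realType} {F : numFieldType} (sc : scalars R F).
Local Notation "r %:F" := (emb sc r).
Local Notation N := (nrm sc).

Lemma max_index (b : nat -> R) n :
  exists2 m, (m < n.+1)%N & forall k, (k < n.+1)%N -> b k <= b m.
Proof.
elim: n => [|n [m mn Hm]]; first by exists 0%N => // k; rewrite ltnS leqn0 => /eqP ->.
have [bm|bm] := leP (b m) (b n.+1).
  exists n.+1 => // k; rewrite ltnS leq_eqVlt => /predU1P[-> //|/Hm].
  by move=> /le_trans; apply.
exists m; first exact: ltnW.
by move=> k; rewrite ltnS leq_eqVlt => /predU1P[->|/Hm //]; exact: ltW.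
Qed.

Section c0_sequences.
Variables (E : completeNormedModType F) (y : nat -> E) (T : nat -> {linear E -> F^o}).
Variables (C M s : R) (eta : nat -> R).
Hypothesis C0 : 0 < C.
Hypothesis M0 : 0 < M.
Hypothesis TC : forall k f, N (T k f) <= C * N f.
Hypothesis T0 : forall f e, 0 < e -> exists n0, forall k, (n0 <= k)%N -> N (T k f) < e.
Hypothesis Tdiag : forall k, T k (y k) = 1.
Hypothesis Toff : forall k j, j != k -> N (T k (y j)) <= eta j.
Hypothesis eta0 : forall j, 0 <= eta j.
Hypothesis eta_sum : forall n, \sum_(j < n) eta j <= s.
Hypothesis yM : forall n (a : nat -> F) A, 0 <= A ->
  (forall k, (k < n)%N -> N (a k : F^o) <= A) -> N (\sum_(k < n) a k *: y k) <= M * A.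
Hypothesis s2 : s <= 2^-1.
Hypothesis sCM : C * M * s <= 4^-1.

(** The matrix [T k (y j)] differs from the identity by terms whose sum over j is at
  most s, hence the value of T k at a linear combination is close to its k-th
  coefficient. *)
Let coord_err n (a : nat -> F) A k : 0 <= A ->
  (forall j, (j < n)%N -> N (a j : F^o) <= A) ->
  N (T k (\sum_(j < n) a j *: y j) - (if (k < n)%N then a k else 0)) <= A * s.
Proof.
move=> A0 aA.
have -> : T k (\sum_(j < n) a j *: y j) - (if (k < n)%N then a k else 0) =
    \sum_(j < n) (if j == k :> nat then 0 else a j * T k (y j) : F^o).
  rewrite linear_sum /=; case: ifP => kn.
    rewrite (bigD1 (Ordinal kn)) //= linearZ /= Tdiag [_ *: _]mulr1 addrAC subrr add0r.
    rewrite [RHS] (bigD1 (Ordinal kn)) //= eqxx add0r.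
    by apply: eq_bigr => j; rewrite -val_eqE /= => /negbTE ->; rewrite linearZ.
  rewrite subr0; apply: eq_bigr => j _.
  by rewrite ltn_eqF ?linearZ // (leq_trans (ltn_ord j)) // leqNgt kn.
rewrite (le_trans (@nrm_sum _ _ sc F^o n (fun j => if j == k then 0 else a j * T k (y j)))) //.
apply: (@le_trans _ _ (A * \sum_(j < n) eta j)); last by rewrite ler_wpM2l.
rewrite mulr_sumr; apply: ler_sum => j _; case: eqVneq => jk.
  by rewrite nrm0 mulr_ge0.
rewrite (@nrmZ _ _ sc F^o) ler_pM ?nrm_ge0 ?aA //.
exact: Toff.
Qed.

(** At the index of a largest coefficient the error above is at most half of that
  coefficient. *)
Let coord_bound n (a : nat -> F) k : (k < n)%N ->
  N (a k : F^o) <= 2 * C * N (\sum_(j < n) a j *: y j).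
Proof.
case: n => // n kn; set z := \sum_(j < _) _.
have [m mn Hm] := max_index (fun k => N (a k : F^o)) n.
have := @coord_err n.+1 a (N (a m : F^o)) m (nrm_ge0 _ _) Hm; rewrite mn -/z => zm.
have := nrm_le_dist sc (a m : F^o) (T m z); rewrite (nrm_distC sc (a m : F^o)).
have : N (a m : F^o) * s <= N (a m : F^o) * 2^-1 by rewrite ler_wpM2l ?nrm_ge0.
have := TC m z; have := Hm _ kn; lra.
Qed.

Lemma c0_sequence_independent : independent y.
Proof.
move=> n a az k kn; apply: (@nrm_eq0 _ _ sc F^o).
by apply/eqP; rewrite eq_le nrm_ge0 andbT; have := coord_bound a kn; rewrite az nrm0 mulr0.
Qed.

(** The sequence y behaves like the unit vectors of c_0, so the series
  [Q f = \sum_k T k f *: y k] converges for all f, and T is close enough to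
  the coordinate functionals of y for Q to be close to the identity. *)
Lemma c0_sequence_complemented : complemented (closed_span sc y).
Proof.
pose q n f := \sum_(k < n) T k f *: y k.
have qtail f m n A : (m <= n)%N -> 0 <= A -> (forall k, (m <= k)%N -> N (T k f) <= A) ->
    N (q n f - q m f) <= M * A.
  move=> mn A0 TA; rewrite /q (sum_pad (T ^~ f) y mn) -sumrB.
  under eq_bigr => k _ do rewrite -scalerBl.
  apply: (yM (a := fun k => T k f - (if (k < m)%N then T k f else 0))) => // k kn.
  by case: ifP => km; [rewrite subrr nrm0|rewrite subr0 TA // leqNgt km].
have H f : exists l, tends sc (q ^~ f) l.
  apply: cauchy_tends => e e0.
  have eM0 : 0 < e / M / 2 by rewrite !divr_gt0.
  have [n0 Hn0] := T0 f eM0; exists n0 => m n n0m mn.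
  apply: le_lt_trans (qtail f m n (e / M / 2) mn (ltW eM0) _) _.
    by move=> k mk; apply/ltW/Hn0; exact: leq_trans n0m mk.
  by rewrite mulrA [M * _]mulrC divfK ?gt_eqF //; lra.
have [Q0 HQ] := choice H.
have Qlin : linear Q0.
  move=> a f g; apply: tends_unique (HQ _) _ => e e0.
  have [n0 Hn0] := tends_lin a (HQ f) (HQ g) e0.
  exists n0 => n /Hn0; congr (_ < _); congr (N (_ - _)).
  rewrite /q scaler_sumr -big_split /=; apply: eq_bigr => k _.
  have -> : T k (a *: f + g) = a * T k f + T k g by rewrite linearP.
  by rewrite scalerDl scalerA.
pose Q : {linear E -> E} := HB.pack Q0 (GRing.isLinear.Build _ _ _ _ _ Qlin).
have qle n f : N (q n f) <= M * C * N f.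
  rewrite -mulrA; apply: (yM (a := T ^~ f)) => [|k _]; last exact: TC.
  by apply: mulr_ge0; [exact: ltW|exact: nrm_ge0].
have Qle f : N (Q f) <= M * C * N f.
  by apply: (tends_le (HQ f)); exists 0%N => n _; exact: qle.
have [_ _ clZ] := closed_span_subspace sc y.
apply: (@complemented_near_projection _ _ sc _ _ Q (M * C)) => //.
- exact: closed_span_subspace.
- move=> f; apply: tends_closed clZ (HQ f) _ => n.
  exact: (closed_span_sum sc y n (fun k => T k f)).
pose D x := Q x - x.
have Dlin : linear D by move=> a u v; rewrite /D linearD linearZ /= scalerBr opprD addrACA.
pose DL : {linear E -> E} := HB.pack D (GRing.isLinear.Build _ _ _ _ _ Dlin).
pose G (x : E) := (2^-1)%:F *: x.
have Glin : linear G by move=> a u v; rewrite /G scalerDr scalerA mulrC -scalerA.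
pose GL : {linear E -> E} := HB.pack G (GRing.isLinear.Build _ _ _ _ _ Glin).
have NG x : N (G x) = 2^-1 * N x by rewrite nrmZr ger0_norm //; lra.
move=> z Zz; rewrite -NG.
apply: (@closed_span_le _ _ sc _ y E E DL GL (M * C + 1) 2^-1 _ _ _ z Zz).
- by move=> x; rewrite (le_trans (nrmB _ _ _)) // mulrDl mul1r lerD2r.
- by move=> x; rewrite /= NG.
move=> n a /=; rewrite NG /D; set x := \sum_(k < n) _.
apply: (@tends_le _ _ sc E (fun m => (-1) *: (0 *: x + x) + q m x)).
  move=> e /(HQ x)[n0 Hn0]; exists n0 => m /Hn0; congr (_ < _); congr N.
  by rewrite scale0r add0r scaleN1r opprB addrACA addNr add0r.
exists n => m nm; rewrite scale0r add0r scaleN1r addrC.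
rewrite [X in _ - X] (sum_pad a y nm) /q -sumrB.
under eq_bigr => k _ do rewrite -scalerBl.
apply: le_trans (yM (A := 2 * C * N x * s)
  (a := fun k => T k x - (if (k < n)%N then a k else 0)) _ _) _.
- have : 0 <= s by have := eta_sum 0; rewrite big_ord0.
  by move=> s0; rewrite !mulr_ge0 ?nrm_ge0 // ltW.
- move=> k _; apply: coord_err => [|j]; last exact: coord_bound.
  by rewrite !mulr_ge0 ?nrm_ge0 // ltW.
- have : C * M * s * N x <= 4^-1 * N x by rewrite ler_wpM2r ?nrm_ge0.
  lra.
Qed.

End c0_sequences.

(** Recursive choice in which each term may depend on all the earlier ones, which it
  sees as the values below n of a function. *)
Lemma history_choice (A : Type) (d : A) (P : nat -> (nat -> A) -> A -> Prop) :
  (forall n f, exists t, P n f t) ->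
  exists f, forall n, P n (nth d (mkseq f n)) (f n).
Proof.
move=> HP.
have H (l : seq A) : exists t, P (size l) (nth d l) t by exact: HP.
have [g Hg] := choice H.
pose L := fix L n := if n is m.+1 then rcons (L m) (g (L m)) else [::].
have sL n : size (L n) = n by elim: n => //= n IH; rewrite size_rcons IH.
pose f n := g (L n).
have Lf n : L n = mkseq f n.
  by elim: n => //= n IH; rewrite mkseqS -IH.
by exists f => n; have := Hg (L n); rewrite sL -/(f n) Lf.
Qed.

Section singular_families.
Variables (E X : normedModType F) (I : Type) (ev : I -> {linear E -> X}).
Hypothesis ev1 : forall i x, N (ev i x) <= N x.

(** If no subspace of Y bounds the seminorm [sup_i N (ev i y)] below, then this
  seminorm is small on a whole subspace. It is spanned by vectors y_k on which
  the seminorm decreases fast, chosen in the kernels of norming functionals of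
  the earlier ones: then the k-th coordinate of a vector of the span is at most
  2^k times its norm. *)
Lemma singular_hereditary (L : set I) (Y : set E) :
  closed_subspace Y -> infinite_dimensional Y ->
  (forall Y1, Y1 `<=` Y -> closed_subspace Y1 -> infinite_dimensional Y1 ->
     forall e, 0 < e ->
     exists2 y, Y1 y /\ y <> 0 & forall i, L i -> N (ev i y) <= e * N y) ->
  forall e, 0 < e -> exists Y1, [/\ Y1 `<=` Y, closed_subspace Y1,
    infinite_dimensional Y1 & forall y, Y1 y -> forall i, L i -> N (ev i y) <= e * N y].
Proof.
move=> cY Yinf sing e e0.
pose T := (E * {phi : {linear E -> F^o} | forall x, N (phi x) <= N x})%type.
pose vec (t : T) := t.1; pose fnl (t : T) : {linear E -> F^o} := sval t.2.
have fnl1 t x : N (fnl t x) <= N x by exact: (svalP t.2).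
pose P (n : nat) (f : nat -> T) (t : T) := [/\ Y (vec t),
  forall i, L i -> N (ev i (vec t)) <= e / 2 * (4^-1) ^+ n,
  forall k, (k < n)%N -> fnl (f k) (vec t) = 0,
  fnl t (vec t) = 1 & N (vec t) = 1].
have [phi0 [phi01 _]] := hahn_banach sc (0 : E).
have [|f Hf] := @history_choice T (0, exist _ phi0 phi01) P.
  move=> n f.
  pose Y1 := Y `&` [set x | forall k, (k < n)%N -> fnl (f k) x = 0].
  have cY1 : closed_subspace Y1.
    apply: (@closed_subspace_kers _ _ _ sc Y (fun k => fnl (f k)) n) => // k.
    by exists 1 => x; rewrite mul1r.
  have iY1 : infinite_dimensional Y1.
    by apply: (infdim_kers (phi := fun k => fnl (f k))) => //; case: cY.
  have en : 0 < e / 2 * 4^-1 ^+ n by rewrite mulr_gt0 ?exprn_gt0 //; lra.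
  have [|v [Yv v0] vs] := sing Y1 _ cY1 iY1 _ en; first by move=> x [].
  have Nv := nrm_gt0 sc v0.
  pose w := (N v)^-1%:F *: v.
  have Nw : N w = 1 by rewrite nrmZr gtr0_norm ?invr_gt0 // mulVf ?gt_eqF.
  have [phi [phi1 phiw]] := hahn_banach sc w.
  have [Yw wk] : Y1 w by exact: subspaceZ.
  exists (w, exist _ phi phi1); split => //=.
  - move=> i Li; rewrite linearZ /= nrmZr gtr0_norm ?invr_gt0 //.
    by rewrite mulrC ler_pdivrMr // vs.
  - by rewrite /fnl /vec /= phiw Nw rmorph1.
pose y k := vec (f k); pose phi k := fnl (f k).
have Yy k : Y (y k) by case: (Hf k).
have ys k i : L i -> N (ev i (y k)) <= e / 2 * (4^-1) ^+ k.
  by case: (Hf k) => _ + _ _ _; apply.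
have phiy j k : (k < j)%N -> phi k (y j) = 0.
  by move=> kj; have [_ _ /(_ _ kj) + _ _] := Hf j; rewrite nth_mkseq.
have y1 k : N (y k) = 1 by case: (Hf k).
have phiyy k : phi k (y k) = 1 by case: (Hf k).
have coord n (a : nat -> F) k : (k < n)%N ->
    N (a k : F^o) <= 2 ^+ k * N (\sum_(j < n) a j *: y j).
  elim/ltn_ind: k => k IH kn; set z := \sum_(j < _) _.
  have zk : phi k z = a k + \sum_(j < k) a j * phi k (y j).
    rewrite /z linear_sum /=.
    under eq_bigr => j _ do rewrite linearZ.
    rewrite /= -(big_mkord xpredT (fun j => a j *: phi k (y j))).
    rewrite (big_cat_nat (leq0n k) (ltnW kn)) /= (big_ltn kn) big_mkord.
    have tail0 : \sum_(k.+1 <= j < n) a j *: phi k (y j) = 0.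
      rewrite big_nat_cond big1 // => j /andP[/andP[kj _] _].
      by rewrite phiy // scaler0.
    by rewrite tail0 phiyy addr0 [_ *: _]mulr1 addrC.
  have -> : a k = phi k z - \sum_(j < k) a j * phi k (y j) by rewrite zk addrK.
  rewrite (le_trans (@nrmB _ _ sc F^o _ _)) //.
  have := @nrm_sum _ _ sc F^o k (fun j => a j * phi k (y j)).
  have := fnl1 (f k) z; rewrite -/(phi k).
  have : \sum_(j < k) N (a j * phi k (y j) : F^o) <= (2 ^+ k - 1) * N z.
    have -> : (2 ^+ k - 1 : R) = \sum_(j < k) 2 ^+ j.
      by rewrite subrX1 -natr1 addrK mul1r; apply: eq_bigr => j _.
    rewrite mulr_suml; apply: ler_sum => j _; rewrite (@nrmZ _ _ sc F^o).
    rewrite -[leRHS]mulr1; apply: ler_pM; rewrite ?nrm_ge0 //.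
      by apply: IH => //; exact: ltn_trans (ltn_ord j) kn.
    by rewrite (le_trans (fnl1 _ _)) // y1.
  by lra.
have sum_small n : \sum_(k < n) 2 ^+ k * (e / 2 * (4^-1) ^+ k) <= e.
  suff -> : \sum_(k < n) 2 ^+ k * (e / 2 * (4^-1) ^+ k) = e * (1 - 2^-1 ^+ n).
    have : 0 < (2^-1 : R) ^+ n by rewrite exprn_gt0 //; lra.
    by move: (2^-1 ^+ n) => q; nra.
  elim: n => [|n IH]; first by rewrite big_ord0 subrr mulr0.
  rewrite big_ord_recr /= IH mulrCA -exprMn (_ : 2 * 4^-1 = 2^-1 :> R); last by field.
  by rewrite exprS; field.
exists (closed_span sc y); split.
- exact: closed_span_min.
- exact: closed_span_subspace.
- apply: infdim_independent; first exact: closed_span_gen.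
  move=> n a az k kn; apply: (@nrm_eq0 _ _ sc F^o).
  by apply/eqP; rewrite eq_le nrm_ge0 andbT; have := coord n a k kn; rewrite az nrm0 mulr0.
move=> x xy i Li.
pose G (v : E) := e%:F *: v.
have Glin : linear G by move=> a u v; rewrite /G scalerDr scalerA mulrC -scalerA.
pose GL : {linear E -> E} := HB.pack G (GRing.isLinear.Build _ _ _ _ _ Glin).
have NG v : N (G v) = e * N v by rewrite nrmZr gtr0_norm.
rewrite -NG; apply: (@closed_span_le _ _ sc _ y X E (ev i) GL 1 e _ _ _ x xy).
- by move=> v; rewrite mul1r.
- by move=> v; rewrite /= NG.
move=> n a; rewrite /= NG; set z := \sum_(k < n) _.
rewrite /z linear_sum /=.
under eq_bigr => k _ do rewrite linearZ.
apply: le_trans (@nrm_sum _ _ sc X n (fun k => a k *: ev i (y k))) _.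
apply: (@le_trans _ _ (\sum_(k < n) (2 ^+ k * (e / 2 * (4^-1) ^+ k)) * N z)).
  apply: ler_sum => k _; rewrite nrmZ mulrAC.
  by apply: ler_pM; rewrite ?nrm_ge0 //; [exact: coord|exact: ys].
by rewrite -mulr_suml ler_wpM2r ?nrm_ge0.
Qed.

End singular_families.

End sequences_of_vectors.

(** * Spaces of continuous functions *)

Section evaluation.
Context {R : realType} {F : numFieldType} (sc : scalars R F).
Context (hF : has_nonneg_suprema F) {K : topologicalType} (cK : compact [set: K]).
Context (X : normedModType F).
Local Notation E := (C[hF](cK, X)).
Local Notation N := (nrm sc).

Lemma csp_eval_linear t : linear (fun f : E => csp_fun f t).
Proof. by []. Qed.

Definition csp_eval t : {linear E -> X} :=
  HB.pack (fun f : E => csp_fun f t) (GRing.isLinear.Build _ _ _ _ _ (csp_eval_linear t)).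

Lemma nrm_csp_eval t (f : E) : N (csp_eval t f) <= N f.
Proof. by rewrite nrm_le nrmE /= le_csp_norm. Qed.

Lemma nrm_csp_le (f : E) M : 0 <= M -> (forall t, N (csp_eval t f) <= M) -> N f <= M.
Proof.
by move=> M0 fM; rewrite nrm_le; apply: csp_norm_le; rewrite ?emb_ge0 // => t; rewrite -nrm_le fM.
Qed.

Lemma csp_eval_near (f : E) p e : 0 < e ->
  nbhs p [set s | N (csp_eval p f - csp_eval s f) < e].
Proof.
move=> e0; have e0' : 0 < emb sc e by rewrite emb_gt0.
have /cvgrPdist_lt/(_ _ e0') := @csp_cts _ hF _ cK X f p.
by apply: filterS => s /=; rewrite -nrm_lt.
Qed.

Lemma csp_evalZ t a (f : E) : csp_eval t (a *: f) = a *: csp_eval t f.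
Proof. by []. Qed.


Definition csp_const (x : X) : E := csp_mk hF cK (fun t => @cvg_cst _ x _ (nbhs t) _).

Lemma csp_const_linear : linear csp_const.
Proof. by move=> a x y; apply: csp_ext. Qed.

Lemma csp_evalP t a (f g : E) :
  csp_eval t (a *: f + g) = a *: csp_eval t f + csp_eval t g.
Proof. by []. Qed.

End evaluation.
Arguments csp_eval : simpl never.

Definition is_metric (R : realType) (K : topologicalType) (d : K -> K -> R) :=
  [/\ forall x y, d x y = 0 <-> x = y, forall x y, d x y = d y x,
      forall x y z, d x z <= d x y + d y z
    & forall (x : K) (A : set K),
        nbhs x A <-> exists2 e : R, 0 < e & [set y | d x y < e] `<=` A].

Section metric.
Context {R : realType} {K : topologicalType} (d : K -> K -> R) (dm : is_metric d).

Lemma metric_refl x : d x x = 0.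
Proof. by case: dm => d0 _ _ _; apply/d0. Qed.

Lemma metric_ge0 x y : 0 <= d x y.
Proof.
case: dm => _ dC dD _; have := dD x y x; rewrite metric_refl (dC y x); lra.
Qed.

Lemma metric_gt0 x y : x <> y -> 0 < d x y.
Proof.
move=> xy; rewrite lt_neqAle metric_ge0 andbT eq_sym; apply/eqP.
by case: dm => d0 _ _ _ /d0.
Qed.

Lemma nbhs_metric x e : 0 < e -> nbhs x [set y | d x y < e].
Proof. by move=> e0; case: dm => _ _ _ dn; apply/dn; exists e. Qed.

Lemma closed_annulus p r s : closed [set t | r <= d p t <= s].
Proof.
case: dm => d0 dC dD _ t tA; apply/andP; rewrite !leNgt; split; apply/negP => H.
  have rd : 0 < r - d p t by lra.
  have [u [/andP[ru _] /= tu]] := tA _ (nbhs_metric t rd).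
  by have := dD p t u; lra.
have sd : 0 < d p t - s by lra.
have [u [/andP[_ us] /= tu]] := tA _ (nbhs_metric t sd).
by have := dD p u t; rewrite (dC u t); lra.
Qed.

End metric.

(** * Gliding humps *)

Section gliding_hump.
Context {R : realType} {F : numFieldType} (sc : scalars R F).
Context (hF : has_nonneg_suprema F) {K : topologicalType} (cK : compact [set: K]).
Context (X : completeNormedModType F).
Local Notation E := (C[hF](cK, X)).
Local Notation N := (nrm sc).
Local Notation "f $[ t ]" := (csp_eval hF cK X t f)
  (at level 1, left associativity, format "f $[ t ]").
Context (d : K -> K -> R) (dm : is_metric d).

(** The vectors y_k peak at points t_k tending to p and are small at p and on the
  rest of W, so they span a copy of c_0. The functionals
  [f |-> phi_k (f t_k - f p)] tend to 0 at every f, by continuity at p. *)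
Lemma gliding_hump (Y : set E) (W : set K) (p : K) (b : R) :
  closed_subspace Y -> 0 < b ->
  (forall y, Y y -> y <> 0 -> exists2 t, W t & b * N y < N (y$[t])) ->
  (forall r e, 0 < r -> 0 < e -> exists y, [/\ Y y, N y = 1, N (y$[p]) <= e
     & forall t, W t -> r <= d p t -> N (y$[t]) <= e]) ->
  exists Z, [/\ Z `<=` Y, closed_subspace Z, infinite_dimensional Z & complemented Z].
Proof.
move=> cY b0 Yb Ysmall.
have b1 : b < 1.
  have [y [Yy y1 _ _]] := Ysmall 1 1 ltr01 ltr01.
  have [|t _] := Yb y Yy; first by move=> y0; move: y1; rewrite y0 nrm0; lra.
  by have := nrm_csp_eval sc t y; rewrite y1 mulr1; lra.
(* The functionals and the basis constant below are of order 1/b, and the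
   perturbation e0/b must be small compared with the square of b. *)
pose e0 := b ^+ 3 / 400.
have bn0 : b != 0 by rewrite gt_eqF.
have b3 : 0 < b ^+ 3 by rewrite exprn_gt0.
have e00 : 0 < e0 by apply: divr_gt0; [exact: b3|rewrite ltr0n].
have e0b : 400 * e0 <= b by rewrite /e0 !exprS expr0; nra.
pose e k : R := e0 * 2^-1 ^+ k.
have e_gt0 k : 0 < e k by rewrite /e mulr_gt0 // exprn_gt0 //; lra.
have e_le k : e k <= e0.
  have h : (2^-1 : R) ^+ k <= 1 by apply: exprn_ile1; lra.
  by rewrite /e; nra.
have e_sum n : \sum_(k < n) e k <= 2 * e0.
  suff -> : \sum_(k < n) e k = 2 * e0 * (1 - 2^-1 ^+ n).
    have : 0 < (2^-1 : R) ^+ n by rewrite exprn_gt0 //; lra.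
    by move: (2^-1 ^+ n) => q; nra.
  elim: n => [|n IH]; first by rewrite big_ord0 subrr mulr0.
  by rewrite big_ord_recr /= IH /e exprS; field.
pose step (n : nat) (r : R) (u : E * K * R) := let: (y, t, r') := u in
  [/\ [/\ Y y, N y = 1 & N (y$[p]) <= e n],
      [/\ W t, b < N (y$[t]) & d p t < r],
      forall s, W s -> r <= d p s -> N (y$[s]) <= e n,
      0 < r' <= r / 2
    & forall s, d p s < r' -> N (y$[s]) <= 2 * e n].
have step_ex (q : nat * R) : exists u, 0 < q.2 -> step q.1 q.2 u.
  case: q => n r /=; have [r0|r0] := ltP 0 r; last by exists (0, p, 0).
  have [y [Yy y1 yp yW]] := Ysmall r (e n) r0 (e_gt0 n).
  have [|t Wt] := Yb y Yy; first by move=> y0; move: y1; rewrite y0 nrm0; lra.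
  rewrite y1 mulr1 => yt.
  have ptr : d p t < r.
    by rewrite ltNge; apply/negP => /(yW _ Wt); have := e_le n; lra.
  have := csp_eval_near sc y p (e_gt0 n).
  case: dm => _ _ _ dn => /dn[r' r'0 Hr'].
  exists (y, t, Num.min r' (r / 2)) => _; split => //.
    by rewrite lt_min r'0 ge_min lexx orbT andbT; lra.
  move=> s; rewrite lt_min => /andP[/Hr' /= ps _].
  by have := nrm_le_dist sc (y$[s]) (y$[p]); rewrite nrm_distC; lra.
have [g Hg] := choice step_ex.
pose rho := fix rho n := if n is m.+1 then (g (m, rho m)).2 else 1.
have rho0 n : 0 < rho n.
  elim: n => [|n IH] /=; first exact: ltr01.
  have := Hg (n, rho n) IH; rewrite /step /=.
  by case: (g _) => [[y t] r'] /= [_ _ _ /andP[]].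
pose y n := (g (n, rho n)).1.1; pose t n := (g (n, rho n)).1.2.
have Hyt n : step n (rho n) (y n, t n, rho n.+1).
  by have := Hg (n, rho n) (rho0 n); rewrite /y /t /=; case: (g _) => [[]].
have Yy n : Y (y n) by case: (Hyt n) => -[].
have y1 n : N (y n) = 1 by case: (Hyt n) => -[].
have yp n : N ((y n)$[p]) <= e n by case: (Hyt n) => -[].
have Wt n : W (t n) by case: (Hyt n) => _ [].
have yt n : b < N ((y n)$[t n]) by case: (Hyt n) => _ [].
have tr n : d p (t n) < rho n by case: (Hyt n) => _ [].
have yfar n s : W s -> rho n <= d p s -> N ((y n)$[s]) <= e n by case: (Hyt n) => _ _ + _ _; apply.
have ynear n s : d p s < rho n.+1 -> N ((y n)$[s]) <= 2 * e n by case: (Hyt n) => _ _ _ _; apply.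
have rho_half n : rho n.+1 <= rho n / 2 by case: (Hyt n) => _ _ _ /andP[].
have rho_dec m n : (m <= n)%N -> rho n <= rho m.
  elim: n => [|n IH]; first by rewrite leqn0 => /eqP ->.
  rewrite leq_eqVlt => /predU1P[-> //|/IH]; apply: le_trans.
  by have := rho_half n; have := rho0 n; lra.
have rho_exp n : rho n <= 2^-1 ^+ n.
  elim: n => [|n IH]; first by rewrite expr0.
  by rewrite exprS; have := rho_half n; lra.
(* At each point of W at most one of the y_k is large. *)
have one_large s j k : W s -> (j < k)%N -> 2 * e j < N ((y j)$[s]) -> N ((y k)$[s]) <= e k.
  move=> Ws jk yjs; apply: yfar => //.
  apply: (@le_trans _ _ (rho j.+1)); first exact: rho_dec.
  by rewrite leNgt; apply/negP => /ynear; lra.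
have ysum s n (a : nat -> F) A : W s -> 0 <= A -> (forall k, (k < n)%N -> N (a k : F^o) <= A) ->
    N ((\sum_(k < n) a k *: y k)$[s]) <= 2 * A.
  move=> Ws A0 aA; rewrite linear_sum.
  under eq_bigr => k _ do rewrite csp_evalZ.
  apply: le_trans (@nrm_sum _ _ sc X n (fun k => a k *: ((y k)$[s]))) _.
  apply: (@le_trans _ _ (\sum_(k < n) A * N ((y k)$[s]))).
    by apply: ler_sum => k _; rewrite nrmZ ler_wpM2r ?nrm_ge0 ?aA.
  rewrite -mulr_sumr mulrC ler_wpM2r //.
  have [[m mn ms]|nlarge] := pselect (exists2 m, (m < n)%N & 2 * e m < N ((y m)$[s])).
    have small k : k != m -> N ((y k)$[s]) <= 2 * e k.
      rewrite neq_ltn => /orP[km|mk].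
        rewrite leNgt; apply/negP => /(one_large s k m Ws km).
        by have := e_gt0 m; lra.
      by have := one_large s m k Ws mk ms; have := e_gt0 k; lra.
    rewrite (bigD1 (Ordinal mn)) //=.
    have : N ((y m)$[s]) <= 1 by rewrite -(y1 m) nrm_csp_eval.
    have : \sum_(k < n | k != Ordinal mn) N ((y k)$[s]) <= \sum_(k < n) 2 * e k.
      rewrite [leRHS] (bigD1 (Ordinal mn)) //= -[leLHS]add0r.
      apply: lerD; first by rewrite mulr_ge0 // ltW.
      by apply: ler_sum => k; rewrite -val_eqE /= => /small.
    by rewrite -mulr_sumr; have := e_sum n; lra.
  apply: (@le_trans _ _ (\sum_(k < n) 2 * e k)).
    apply: ler_sum => k _; rewrite leNgt; apply/negP => yk; apply: nlarge.
    by exists k.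
  by rewrite -mulr_sumr; have := e_sum n; lra.
pose v k := (y k)$[t k] - (y k)$[p].
have Nv k : b / 2 <= N (v k).
  have := nrm_le_dist sc ((y k)$[t k]) ((y k)$[p]); rewrite -/(v k).
  by have := yt k; have := yp k; have := e_le k; lra.
have phi_ex k : exists phi : {linear X -> F^o},
    (forall x, N (phi x) <= N x) /\ phi (v k) = emb sc (N (v k)).
  exact: hahn_banach.
have [phi Hphi] := choice phi_ex.
pose dif k (f : E) : X := f$[t k] - f$[p].
have dif_lin k a f h : dif k (a *: f + h) = a *: dif k f + dif k h.
  by rewrite /dif !csp_evalP opprD addrACA scalerBr.
pose T0 k (f : E) : F^o := emb sc (N (v k))^-1 * phi k (dif k f).
have T0lin k : linear (T0 k).
  by move=> a f h; rewrite /T0 dif_lin linearP mulrDr -scalerAr.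
pose T k : {linear E -> F^o} := HB.pack (T0 k) (GRing.isLinear.Build _ _ _ _ _ (T0lin k)).
have vinv k : 0 < (N (v k))^-1 <= 2 / b.
  have v0 : 0 < N (v k) by have := Nv k; lra.
  rewrite invr_gt0 v0 /= -[leRHS]invrK lef_pV2 ?posrE ?invr_gt0 ?divr_gt0 //.
  by rewrite invf_div.
have Tle k f : N (T k f) <= 2 / b * N (f$[t k] - f$[p]).
  rewrite /T /= /T0 (@nrmZ _ _ sc F^o) nrm_scalar_emb.
  have /andP[i0 i1] := vinv k.
  by apply: ler_pM => //; rewrite ?nrm_ge0 ?(gtr0_norm i0) //; exact: (Hphi k).1.
have tp n : d p (t n) < 2^-1 ^+ n by apply: lt_le_trans (tr n) _.
pose eta k := 6 / b * e k.
exists (closed_span sc y).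
have b2 : 0 < 2 / b by rewrite divr_gt0.
have s_le : 12 / b * e0 <= b ^+ 2 / 32.
  rewrite /e0 (_ : 12 / b * (b ^+ 3 / 400) = 12 / 400 * b ^+ 2); last by field.
  by rewrite mulrC ler_pM2l ?exprn_gt0 //; lra.
have b21 : b ^+ 2 <= 1 by rewrite expr_le1 // ltW.
have [Hindep Hcompl] : independent y /\ complemented (closed_span sc y).
  have H1 k f : N (T k f) <= 4 / b * N f.
    apply: le_trans (Tle k f) _.
    have := nrmB sc (f$[t k]) (f$[p]).
    have := nrm_csp_eval sc (t k) f; have := nrm_csp_eval sc p f.
    rewrite (_ : 4 / b = 2 / b * 2); last by field.
    by rewrite -[2 / b * 2 * _]mulrA ler_pM2l //; lra.
  have H2 f c : 0 < c -> exists n0, forall k, (n0 <= k)%N -> N (T k f) < c.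
    move=> c0; have cb0 : 0 < c / (2 / b) by rewrite divr_gt0.
    have := csp_eval_near sc f p cb0.
    case: dm => _ _ _ dn => /dn[r r0 Hr].
    have [n0 Hn0] := half_exp_small r0; exists n0 => k /Hn0 kr.
    apply: le_lt_trans (Tle k f) _; rewrite mulrC -ltr_pdivlMr //.
    by rewrite nrm_distC; apply: Hr => /=; exact: lt_trans (tp k) kr.
  have H3 k : T k (y k) = 1.
    rewrite /T /= /T0 -/(v k) (Hphi k).2 -rmorphM mulVf ?rmorph1 //.
    by rewrite gt_eqF //; have := Nv k; lra.
  have H4 k j : j != k -> N (T k (y j)) <= eta j.
    move=> jk; apply: le_trans (Tle k _) _.
    rewrite /eta (_ : 6 / b = 2 / b * 3); last by field.
    rewrite -[2 / b * 3 * _]mulrA ler_pM2l //; have := nrmB sc ((y j)$[t k]) ((y j)$[p]).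
    have : N ((y j)$[t k]) <= 2 * e j.
      move: jk; rewrite neq_ltn => /orP[jk|kj].
        by apply: ynear; apply: lt_le_trans (tr k) _; exact: rho_dec.
      suff : N ((y j)$[t k]) <= e j by have := e_gt0 j; lra.
      by apply: (one_large _ k j) => //; have := yt k; have := e_le k; lra.
    by have := yp j; lra.
  have H5 k : 0 <= eta k by rewrite /eta mulr_ge0 ?ltW // divr_gt0.
  have H6 n : \sum_(k < n) eta k <= 12 / b * e0.
    rewrite /eta -mulr_sumr (_ : 12 / b = 6 / b * 2); last by field.
    by rewrite -[6 / b * 2 * _]mulrA ler_pM2l // divr_gt0.
  have H7 n (a : nat -> F) A : 0 <= A -> (forall k, (k < n)%N -> N (a k : F^o) <= A) ->
      N (\sum_(k < n) a k *: y k) <= 2 / b * A.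
    move=> A0 aA; set z := \sum_(k < n) _.
    have [->|/eqP z0] := eqVneq z 0; first by rewrite nrm0 mulr_ge0 // ltW.
    have Yz : Y z.
      apply: (subspace_sum (u := fun k => a k *: y k)) => // k _.
      by apply: subspaceZ.
    have [s Ws zs] := Yb z Yz z0.
    have := ysum s n a A Ws A0 aA; rewrite -/z => zs'.
    by rewrite mulrAC ler_pdivlMr // mulrC; lra.
  have C40 : 0 < 4 / b by rewrite divr_gt0.
  have H8 : 12 / b * e0 <= 2^-1 by lra.
  have H9 : 4 / b * (2 / b) * (12 / b * e0) <= 4^-1.
    have -> : 4 / b * (2 / b) * (12 / b * e0) = 8 / b ^+ 2 * (12 / b * e0).
      by field.
    apply: le_trans (_ : 8 / b ^+ 2 * (b ^+ 2 / 32) <= _).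
      by rewrite ler_pM2l // divr_gt0 // exprn_gt0.
    by rewrite le_eqVlt; apply/orP; left; apply/eqP; field.
  split.
    exact: (c0_sequence_independent H1 H3 H4 H5 H6 H8).
  exact: (c0_sequence_complemented C40 b2 H1 H2 H3 H4 H5 H6 H7 H8 H9).
split.
- exact: closed_span_min.
- exact: closed_span_subspace.
- by apply: infdim_independent Hindep; exact: closed_span_gen.
- exact: Hcompl.
Qed.

End gliding_hump.

(** * Subprojectivity over a scattered compact space *)

Section scattered_subprojective.
Context {R : realType} {F : numFieldType} (sc : scalars R F).
Context (hF : has_nonneg_suprema F) {K : topologicalType} (cK : compact [set: K]).
Context (X : completeNormedModType F).
Local Notation E := (C[hF](cK, X)).
Local Notation N := (nrm sc).
Local Notation "f $[ t ]" := (csp_eval hF cK X t f)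
  (at level 1, left associativity, format "f $[ t ]").

(** Restriction to a null set is a strictly singular operator on Y, in the
  hereditary form that makes null sets stable under finite unions. *)
Definition null_on (Y : set E) (L : set K) := forall Y0, Y0 `<=` Y ->
  closed_subspace Y0 -> infinite_dimensional Y0 -> forall e, 0 < e ->
  exists Y1, [/\ Y1 `<=` Y0, closed_subspace Y1, infinite_dimensional Y1
    & forall y, Y1 y -> forall t, L t -> N (y$[t]) <= e * N y].

Lemma null_onS Y A B : A `<=` B -> null_on Y B -> null_on Y A.
Proof.
move=> AB nB Y0 Y0Y cY0 iY0 e e0; have [Y1 [Y10 cY1 iY1 Y1e]] := nB _ Y0Y cY0 iY0 _ e0.
by exists Y1; split => // y /Y1e + t /AB; apply.
Qed.

Lemma null_on0 Y : null_on Y set0.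
Proof. by move=> Y0 Y0Y cY0 iY0 e e0; exists Y0; split. Qed.

Lemma null_onU Y A B : null_on Y A -> null_on Y B -> null_on Y (A `|` B).
Proof.
move=> nA nB Y0 Y0Y cY0 iY0 e e0.
have [Y1 [Y10 cY1 iY1 Y1e]] := nA _ Y0Y cY0 iY0 _ e0.
have [Y2 [Y21 cY2 iY2 Y2e]] := nB _ (subset_trans Y10 Y0Y) cY1 iY1 _ e0.
exists Y2; split => //; first exact: subset_trans Y21 Y10.
by move=> y Y2y t [At|Bt]; [apply: Y1e => //; exact: Y21|exact: Y2e].
Qed.

Lemma null_on_singular Y L :
  (forall Y0, Y0 `<=` Y -> closed_subspace Y0 -> infinite_dimensional Y0 ->
     forall e, 0 < e ->
     exists2 y, Y0 y /\ y <> 0 & forall t, L t -> N (y$[t]) <= e * N y) ->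
  null_on Y L.
Proof.
move=> sing Y0 Y0Y cY0 iY0.
apply: (singular_hereditary (ev := csp_eval hF cK X)) => //.
  by move=> t y; exact: nrm_csp_eval.
by move=> Y1 Y10; apply: sing; exact: subset_trans Y10 Y0Y.
Qed.

(** The complements of null sets in A form a filter, which is improper only when A
  is null. *)
Lemma null_on_compact Y A : compact A ->
  (forall t, A t -> exists2 U, nbhs t U & null_on Y U) -> null_on Y A.
Proof.
move=> cA Aloc; pose G : set_system K := [set B | null_on Y (A `\` B)].
have Gfilter : Filter G.
  split.
  - by rewrite /G /= setDT; exact: null_on0.
  - by move=> B C GB GC; rewrite /G /= setDIr; exact: null_onU.
  - by move=> B C BC; apply: null_onS => t [At nC]; split => // /BC.
apply: contrapT => nA.
have Gproper : ProperFilter G by split => //; rewrite /G /= setD0.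
have GA : G A by rewrite /G /= setDv; exact: null_on0.
have [t [At Gt]] := cA G Gproper GA.
have [U tU nU] := Aloc t At.
have GU : G (~` U) by apply: null_onS nU => s [_ /contrapT].
by have [s []] := Gt _ _ GU tU.
Qed.

(** The points without a null neighbourhood form a closed set B, nonempty since K
  is not null. Small closed annuli around an isolated point p of B are null, so a
  subspace of Y on which restriction to a neighbourhood of p is bounded below
  contains vectors concentrated arbitrarily close to p. *)
Theorem scattered_csp_subprojective : metrizable R K -> scattered K ->
  subprojective X -> subprojective E.
Proof.
move=> [d dm] scK spX Y cY iY; apply: contrapT => noZ.
have noZ' Y0 : Y0 `<=` Y -> closed_subspace Y0 -> infinite_dimensional Y0 ->
    ~ exists Z, [/\ Z `<=` Y0, closed_subspace Z, infinite_dimensional Z & complemented Z].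
  move=> Y0Y _ _ [Z [ZY0 cZ iZ ccZ]]; apply: noZ; exists Z; split => //.
  exact: subset_trans ZY0 Y0Y.
have null1 p : null_on Y [set p].
  apply: null_on_singular => Y0 Y0Y cY0 iY0 e e0; apply: contrapT => large.
  apply: (noZ' _ Y0Y cY0 iY0).
  have ei0 : 0 < e^-1 by rewrite invr_gt0.
  apply: (complemented_pullback (T := csp_eval hF cK X p) (C := 1) _ cY0 iY0 ei0 _ spX).
    by move=> f; rewrite mul1r; exact: (nrm_csp_eval sc).
  move=> y Y0y; rewrite leNgt; apply/negP => ye; apply: large; exists y.
    by split => // y0; move: ye; rewrite y0 linear0 !nrm0 mulr0 ltxx.
  by move=> _ ->; move: ye; rewrite mulrC ltr_pdivrMr // mulrC => /ltW.
pose B : set K := [set t | ~ exists2 U, nbhs t U & null_on Y U].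
have clB : closed B.
  rewrite -[B]setCK; apply: open_closedC; rewrite openE => t /= /contrapT[U tU nU].
  rewrite /interior.
  have : nbhs t (interior U) by exact: nbhs_interior.
  by apply: filterS => s sU; apply; exists U.
have [B0|nB] := pselect (B !=set0); last first.
  have nK : null_on Y [set: K].
    apply: null_on_compact cK _ => t _; apply: contrapT => tB.
    by apply: nB; exists t.
  have h : 0 < (2^-1 : R) by lra.
  have [Y1 [_ [Y10 _ _] iY1 Y1e]] := nK Y (@subset_refl _ Y) cY iY _ h.
  have [y Y1y y0] := infdim_nonzero Y10 iY1.
  have := nrm_gt0 sc y0.
  have : N y <= 2^-1 * N y.
    apply: nrm_csp_le; first by rewrite mulr_ge0 ?nrm_ge0.
    by move=> t; exact: Y1e.
  lra.
have cB : compact B by exact: subclosed_compact clB cK _.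
have [p [/set_mem Bp [V Vp VB]]] := scK B B0 cB.
have [_ _ _ dn] := dm.
have [r r0 rV] := (dn p V).1 Vp.
pose W : set K := [set t | d p t < r / 2].
have r20 : 0 < r / 2 by lra.
apply: Bp; exists W; first exact: (nbhs_metric dm p r20).
have annulus_null q : 0 < q -> null_on Y [set t | q <= d p t <= r / 2].
  move=> q0; apply: null_on_compact.
    apply: (subclosed_compact _ cK) => //.
    exact: (closed_annulus dm).
  move=> t /= /andP[qt tr]; apply: contrapT => Bt.
  have : (V `&` B) t by split => //; apply: rV => /=; lra.
  rewrite VB /= => tp; move: qt; rewrite tp (metric_refl dm); lra.
apply: null_on_singular => Y0 Y0Y cY0 iY0 e e0; apply: contrapT => large.
apply: (noZ' _ Y0Y cY0 iY0).
apply: (gliding_hump (sc := sc) (d := d) dm (W := W) (p := p) (b := e) cY0 e0).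
  move=> y Y0y y0; apply: contrapT => ysmall; apply: large; exists y => // t Wt.
  by rewrite leNgt; apply/negP => yt; apply: ysmall; exists t.
move=> q a q0 a0.
have [Y1 [Y10 cY1 iY1 Y1e]] := null_onU (null1 p) (annulus_null q q0) Y0Y cY0 iY0 a0.
have [Y1z _ _] := cY1.
have [y Y1y y0] := infdim_nonzero Y1z iY1.
have Ny := nrm_gt0 sc y0.
exists ((emb sc (N y)^-1) *: y).
have Nv : N (emb sc (N y)^-1 *: y) = 1.
  by rewrite nrmZr gtr0_norm ?invr_gt0 // mulVf ?gt_eqF.
have Y1v : Y1 (emb sc (N y)^-1 *: y) by exact: subspaceZ.
split => //.
- exact: Y10.
- by have := Y1e _ Y1v p (or_introl erefl); rewrite Nv mulr1.
- move=> t Wt qt; rewrite -[leRHS]mulr1 -Nv; apply: Y1e => //; right.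
  by rewrite /= qt ltW.
Qed.

End scattered_subprojective.

(** * Riesz products *)

Section scalar_functions.
Context {R : realType} {F : numFieldType} (sc : scalars R F).
Context (hF : has_nonneg_suprema F) {K : topologicalType} (cK : compact [set: K]).
Context (X : normedModType F) (x0 : X).
Local Notation E := (C[hF](cK, X)).
Local Notation N := (nrm sc).
Local Notation "f $[ t ]" := (csp_eval hF cK X t f)
  (at level 1, left associativity, format "f $[ t ]").

Lemma scalar_fun_continuous (u : K -> R) :
  continuous u -> continuous (fun t => emb sc (u t) *: x0).
Proof.
move=> cu p; apply/cvgrPdist_lt => e /(emb_gt0_ex sc)[r r0 ->].
have c0 : 0 < N x0 + 1 by have := nrm_ge0 sc x0; lra.
have rc0 : 0 < r / (N x0 + 1) by rewrite divr_gt0.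
have /cvgrPdist_lt/(_ _ rc0) := cu p; apply: filterS => t /=.
rewrite ltr_pdivlMr // => h.
rewrite -scalerBl -rmorphB -nrm_lt nrmZr; apply: le_lt_trans h.
by rewrite ler_wpM2l // lerDl.
Qed.

Definition csp_scalar (u : K -> R) (cu : continuous u) : E :=
  csp_mk hF cK (scalar_fun_continuous cu).

Lemma csp_scalarE u (cu : continuous u) t : (csp_scalar cu)$[t] = emb sc (u t) *: x0.
Proof. by []. Qed.

Lemma csp_eval_inj (f g : E) : (forall t, f$[t] = g$[t]) -> f = g.
Proof. by move=> fg; apply: csp_ext. Qed.

End scalar_functions.
Arguments csp_scalar {R F} sc hF {K} cK {X} x0 {u} cu.

Section riesz_product.
Context {R : realType} {K : topologicalType}.

Definition sgn_bool (b : bool) : R := if b then 1 else -1.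

Definition riesz_prod J (c : R) (u : nat -> K -> R) (s : {ffun 'I_J -> bool}) (t : K) : R[i] :=
  \prod_(j < J) Complex 1 (sgn_bool (s j) * c * u j t).

(** Distributing the sum over the signs, the factor of index j becomes 2 for j <> k,
  and for j = k the difference of [1 + i c u_k] and [1 - i c u_k]. *)
Lemma riesz_prod_sum J c u (k : 'I_J) t :
  \sum_(s : {ffun 'I_J -> bool}) sgn_bool (s k) * complex.Im (riesz_prod c u s t) =
  2 ^+ J * (c * u k t).
Proof.
have -> : \sum_(s : {ffun 'I_J -> bool}) sgn_bool (s k) * complex.Im (riesz_prod c u s t) =
    complex.Im (\sum_(s : {ffun 'I_J -> bool}) \prod_(j < J)
      ((if j == k then (sgn_bool (s j))%:C else 1) * Complex 1 (sgn_bool (s j) * c * u j t))).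
  rewrite (big_morph (@complex.Im R) (id1 := 0) (op1 := +%R)) //; last by move=> [a b] [a' b'].
  apply: eq_bigr => s _; rewrite big_split /= -/(riesz_prod c u s t).
  rewrite -big_mkcond big_pred1_eq /=; case: (riesz_prod c u s t) => a b /=.
  by rewrite mul0r addr0.
rewrite -(bigA_distr_bigA (fun j b =>
  (if j == k then (sgn_bool b)%:C else 1) * Complex 1 (sgn_bool b * c * u j t))) /=.
rewrite (bigD1 k) //= big_bool eqxx /= [X in _ * X] (_ : _ = (2 ^+ J.-1)%:C); last first.
  rewrite (eq_bigr (fun _ => 2%:C)); last first.
    move=> j /negbTE jk; rewrite big_bool jk /= !mul1r.
    by apply/eqP; rewrite eq_complex /= mulN1r mulNr subrr !eqxx.
  by rewrite prodr_const cardC1 card_ord rmorphXn.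
case: J k => [[]//|J k]; simpc => /=; rewrite /sgn_bool exprS /=.
ring.
Qed.

(** The squared modulus of each factor is [1 + c^2 u_j^2]. *)
Lemma riesz_prod_bound J c u (s : {ffun 'I_J -> bool}) t : (forall j, `|u j t| <= 1) ->
  (complex.Im (riesz_prod c u s t)) ^+ 2 <= (1 + c ^+ 2) ^+ J.
Proof.
move=> u1; pose q (z : R[i]) := complex.Re z ^+ 2 + complex.Im z ^+ 2.
have qM : {morph q : x y / x * y} by move=> [a b] [a' b']; rewrite /q /=; ring.
apply: (@le_trans _ _ (q (riesz_prod c u s t))); first by rewrite lerDr sqr_ge0.
rewrite /riesz_prod (big_morph q qM (id1 := 1)); last by rewrite /q /=; ring.
rewrite -[J in leRHS]card_ord -prodr_const; apply: ler_prod => j _.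
rewrite /q /= addr_ge0 ?sqr_ge0 //= expr1n lerD2l.
have : (u j t) ^+ 2 <= 1.
  by rewrite -real_normK ?num_real // expr_le1.
have : 0 <= c ^+ 2 by rewrite sqr_ge0.
have : 0 <= (u j t) ^+ 2 by rewrite sqr_ge0.
by rewrite !exprMn /sgn_bool; case: (s j); rewrite ?sqrrN expr1n mul1r; nra.
Qed.

Lemma riesz_prod_continuous J c u (s : {ffun 'I_J -> bool}) : (forall j, continuous (u j)) ->
  continuous (fun t => complex.Im (riesz_prod c u s t)).
Proof.
move=> cu; suff [] : continuous (fun t => complex.Re (riesz_prod c u s t)) /\
  continuous (fun t => complex.Im (riesz_prod c u s t)) by [].
rewrite /riesz_prod; elim: (index_enum _) => [|j l [cR cI]].
  by split=> t; under eq_fun do rewrite big_nil; exact: cvg_cst.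
pose a t := complex.Re (\prod_(j <- l) Complex 1 (sgn_bool (s j) * c * u j t)).
pose b t := complex.Im (\prod_(j <- l) Complex 1 (sgn_bool (s j) * c * u j t)).
pose v t := sgn_bool (s j) * c * u j t.
have cv : continuous v by move=> t; apply: cvgM; [exact: cvg_cst|exact: cu].
have -> : (fun t => complex.Re (\prod_(j <- j :: l) Complex 1 (sgn_bool (s j) * c * u j t))) =
    (fun t => a t - v t * b t).
  apply/funext => t; rewrite big_cons /a /b /v.
  by case: (\prod_(j <- l) _) => x y /=; rewrite mul1r.
have -> : (fun t => complex.Im (\prod_(j <- j :: l) Complex 1 (sgn_bool (s j) * c * u j t))) =
    (fun t => b t + v t * a t).
  apply/funext => t; rewrite big_cons /a /b /v.
  by case: (\prod_(j <- l) _) => x y /=; rewrite mul1r.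
split=> t.
  by apply: cvgB; [exact: cR|apply: cvgM; [exact: cv|exact: cI]].
by apply: cvgD; [exact: cI|apply: cvgM; [exact: cv|exact: cR]].
Qed.

Lemma expr_1Dx_bound (x : R) n : 0 <= x -> (1 + x) ^+ n * (1 - n%:R * x) <= 1.
Proof.
move=> x0; elim: n => [|n IH]; first by rewrite expr0 mul0r subr0 mul1r.
apply: le_trans IH; rewrite exprSr -mulrA ler_wpM2l ?exprn_ge0 //; first lra.
have : 0 <= (n%:R : R) by [].
rewrite -natr1; nra.
Qed.

Section absolutely_summing.
Context {F : numFieldType} (sc : scalars R F).
Context (hF : has_nonneg_suprema F) (cK : compact [set: K]).
Context (X : normedModType F) (x0 : X).
Local Notation E := (C[hF](cK, X)).
Local Notation N := (nrm sc).

(** If J functionals T_j have uniformly bounded sums of absolute values, then the sum of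
  their values at J bounded real functions u_j grows at most like the square root of J:
  the Riesz products with signs s, imaginary parts of
  [\prod_j (1 + i s_j c u_j)], are bounded when J c^2 <= 1/2, and averaging them
  against the k-th sign gives [c u_k]. This is a form of the cotype 2 property of the
  dual of the space of continuous functions. *)
Lemma riesz_product_sum (u : nat -> K -> R) (cu : forall j, continuous (u j))
    (T : nat -> {linear E -> F^o}) (D c : R) J :
  N x0 = 1 -> 0 <= D -> 0 <= c -> J%:R * c ^+ 2 <= 2^-1 ->
  (forall j t, `|u j t| <= 1) ->
  (forall f, \sum_(j < J) N (T j f) <= D * N f) ->
  c * \sum_(j < J) N (T j (csp_scalar sc hF cK x0 (cu j))) <= 2 * D.
Proof.
move=> Nx0 D0 c0 Jc u1 TD.
pose f (s : {ffun 'I_J -> bool}) : E :=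
  csp_scalar sc hF cK x0 (@riesz_prod_continuous J c u s cu).
have f2 s : N (f s) <= 2.
  apply: nrm_csp_le => // t; rewrite csp_scalarE nrmZr Nx0 mulr1.
  have := riesz_prod_bound c s (fun j => u1 j t).
  have := expr_1Dx_bound J (sqr_ge0 c).
  have : 0 <= (1 + c ^+ 2) ^+ J by rewrite exprn_ge0 // addr_ge0 // sqr_ge0.
  set A := (1 + _) ^+ _; set z := complex.Im _ => A0 A1 zA.
  have A2 : A <= 2 by nra.
  by rewrite ler_norml; apply/andP; split; nra.
have avg (k : 'I_J) : emb sc (2 ^+ J * c) *: csp_scalar sc hF cK x0 (cu k) =
    \sum_(s : {ffun 'I_J -> bool}) emb sc (sgn_bool (s k)) *: f s.
  apply: csp_eval_inj => t; rewrite csp_evalZ linear_sum csp_scalarE.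
  under eq_bigr => s _ do rewrite csp_evalZ csp_scalarE scalerA -rmorphM.
  by rewrite -scaler_suml -rmorph_sum riesz_prod_sum scalerA -rmorphM mulrA.
have one (k : 'I_J) : 2 ^+ J * c * N (T k (csp_scalar sc hF cK x0 (cu k))) <=
    \sum_(s : {ffun 'I_J -> bool}) N (T k (f s)).
  have p0 : 0 <= 2 ^+ J * c by rewrite mulr_ge0 // exprn_ge0.
  rewrite -[X in X * _ <= _] (ger0_norm p0) -(nrm_scalar_emb sc) -(@nrmZ _ _ sc F^o).
  rewrite -[_ *: _]linearZ avg linear_sum.
  have H := @nrm_big_sum _ _ sc F^o _
    (fun s : {ffun 'I_J -> bool} => T k (emb sc (sgn_bool (s k)) *: f s)).
  apply: (le_trans H).
  apply: ler_sum => s _.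
  rewrite linearZ (@nrmZ _ _ sc F^o) nrm_scalar_emb.
  by rewrite /sgn_bool; case: (s k); rewrite ?normrN normr1 mul1r.
have cardJ : \sum_(s : {ffun 'I_J -> bool}) 2 * D = 2 ^+ J * (2 * D).
  by rewrite sumr_const card_ffun card_bool card_ord -[LHS]mulr_natl natrX.
have p2 : 0 < (2 : R) ^+ J by rewrite exprn_gt0.
rewrite -(ler_pM2l p2) mulrA mulr_sumr -cardJ.
apply: le_trans (ler_sum _ (fun k _ => one k)) _.
rewrite exchange_big; apply: ler_sum => s _.
apply: le_trans (TD (f s)) _; rewrite mulrC ler_wpM2r //.
Qed.

End absolutely_summing.
End riesz_product.

(** * Independent functions on a space that is not scattered *)

Section independent_functions.
Context {R : realType} {K : topologicalType} (d : K -> K -> R) (dm : is_metric d).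
Variables (A : set K) (Aperf : forall x, ~ isolated A x).

Lemma nbhs_neq (x y : K) : x <> y -> nbhs x [set s | s <> y].
Proof.
move=> xy; have := nbhs_metric dm x (metric_gt0 dm xy).
by apply: filterS => s /= + sy; rewrite sy ltxx.
Qed.

Lemma nbhs_avoid (x : K) (f : nat -> K) n : (forall k, (k < n)%N -> x <> f k) ->
  nbhs x [set s | forall k, (k < n)%N -> s <> f k].
Proof.
elim: n => [|n IH] xf; first by apply: filterS filterT.
have xn : x <> f n by exact: xf.
have xf' k : (k < n)%N -> x <> f k by move=> kn; apply: xf; exact: ltnW.
apply: filterS (filterI (IH xf') (nbhs_neq xn)) => s [sn sx] k.
by rewrite ltnS leq_eqVlt => /predU1P[->|/sn].
Qed.

(** When the point found so far is the next one to avoid, it is not isolated in A,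
  and a neighbour of it can be taken instead. *)
Lemma perfect_avoid (U : set K) (f : nat -> K) n : open U -> U `&` A !=set0 ->
  exists t, [/\ U t, A t & forall k, (k < n)%N -> t <> f k].
Proof.
move=> oU; elim: n => [|n IH] UA; first by have [t [Ut At]] := UA; exists t.
have [t [Ut At tf]] := IH UA.
have [tn|tn] := pselect (t = f n); last first.
  by exists t; split => // k; rewrite ltnS leq_eqVlt => /predU1P[->|/tf].
have [s [[Us sf] [As st]]] : exists s, (U `&` [set s | forall k, (k < n)%N -> s <> f k]) s /\
    A s /\ s <> t.
  apply: contrapT => nos; apply: (Aperf (x := t)); split; first exact: mem_set.
  exists (U `&` [set s | forall k, (k < n)%N -> s <> f k]).
    by apply: filterI; [exact: open_nbhs_nbhs|exact: nbhs_avoid].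
  apply/seteqP; split=> [s [Us As]|_ ->]; last by split.
  by apply: contrapT => st; apply: nos; exists s.
exists s; split => // k; rewrite ltnS leq_eqVlt => /predU1P[->|/sf //].
by rewrite -tn.
Qed.

Lemma perfect_injective (S : nat -> set K) :
  (forall n, open (S n) /\ S n `&` A !=set0) ->
  exists x : nat -> K, injective x /\ forall n, S n (x n) /\ A (x n).
Proof.
move=> SA; have [p _] := (SA 0%N).2.
pose P n (f : nat -> K) t := [/\ S n t, A t & forall k, (k < n)%N -> t <> f k].
have [|x Hx] := @history_choice K p P.
  by move=> n f; have [oS SAn] := SA n; exact: perfect_avoid.
exists x; split=> [m n xmn|n]; last by case: (Hx n).
have xlt k l : (k < l)%N -> x l <> x k.
  by move=> kl; have [_ _ /(_ _ kl)] := Hx l; rewrite nth_mkseq.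
by case: (ltngtP m n) => // [/xlt|/xlt] //; rewrite xmn.
Qed.

Lemma metric_continuous (x : K) : continuous (d x).
Proof.
move=> t; apply/cvgrPdist_lt => e e0.
apply: filterS (nbhs_metric dm t e0) => s /=.
case: dm => _ dC dD _ ts; rewrite ltr_norml.
by have := dD x t s; have := dD x s t; rewrite (dC s t); lra.
Qed.

Definition clamp (z : R) := Num.max (-1) (Num.min 1 z).

Lemma clamp_norm z : `|clamp z| <= 1.
Proof. by rewrite ler_norml /clamp le_max lexx /= ge_max ge_min lexx /= andbT; lra. Qed.

Lemma clamp_continuous (g : K -> R) : continuous g -> continuous (fun t => clamp (g t)).
Proof.
move=> cg t; apply: (@continuous_max _ _ (fun _ => -1) (fun t => Num.min 1 (g t))).
  exact: cvg_cst.
by apply: (@continuous_min _ _ (fun _ => 1) g); [exact: cvg_cst|exact: cg].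
Qed.

Lemma prod_dist_continuous (x : nat -> K) (p : pred nat) n :
  continuous (fun t => \prod_(k < n | p k) d (x k) t).
Proof.
elim: n => [|n IH] t.
  by under eq_fun do rewrite big_ord0; exact: cvg_cst.
have -> : (fun t => \prod_(k < n.+1 | p k) d (x k) t) =
    (fun t => (\prod_(k < n | p k) d (x k) t) * (if p n then d (x n) t else 1)).
  by apply/funext => s; rewrite big_mkcond big_ord_recr -big_mkcond.
apply: cvgM; first exact: IH.
by case: (p n); [exact: metric_continuous|exact: cvg_cst].
Qed.

(** The products of the distances to the points of either sign vanish exactly on
  these points, so the truncation of
  [3 (f_false - f_true) / (f_true + f_false)] is locally constant around each of them. *)
Lemma finite_separation (x : nat -> K) (b : nat -> bool) n : injective x ->
  exists r : K -> R, [/\ continuous r, forall t, `|r t| <= 1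
    & forall k, (k < n)%N -> nbhs (x k) [set t | r t = sgn_bool (b k)]].
Proof.
move=> xinj.
pose f (c : bool) t := \prod_(k < n | b k == c) d (x k) t.
have f_ge0 c t : 0 <= f c t by apply: prodr_ge0 => k _; exact: (metric_ge0 dm).
have f0 c t : f c t = 0 -> exists2 k, (k < n)%N & b k = c /\ x k = t.
  move=> /eqP; rewrite prodf_seq_eq0 => /hasP[k _ /andP[/eqP bk /eqP xkt]].
  by exists k => //; split => //; case: dm => d0 _ _ _; apply/d0.
have fpos t : 0 < f true t + f false t.
  rewrite lt_neqAle addr_ge0 // andbT eq_sym paddr_eq0 //.
  apply/negP => /andP[/eqP/f0[k _ [bk xk]] /eqP/f0[l _ [bl xl]]].
  by move: bl; rewrite -(xinj k l) ?bk // xk xl.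
have fz k : (k < n)%N -> f (b k) (x k) = 0.
  move=> kn; apply/eqP; rewrite prodf_seq_eq0; apply/hasP.
  exists (Ordinal kn); first by rewrite mem_index_enum.
  by rewrite /= eqxx (metric_refl dm) eqxx.
pose g t := 3 * ((f false t - f true t) / (f true t + f false t)).
have cf c : continuous (f c) by exact: (@prod_dist_continuous x (fun k => b k == c) n).
have cg : continuous g.
  move=> t; apply: cvgM; first exact: cvg_cst.
  apply: cvgM; first by apply: cvgB; exact: cf.
  by apply: cvgV; [rewrite gt_eqF|apply: cvgD; exact: cf].
have gx k : (k < n)%N -> g (x k) = 3 * sgn_bool (b k).
  move=> kn; have := fpos (x k); have := fz k kn; rewrite /g /sgn_bool.
  case: (b k) => ->; rewrite ?subr0 ?sub0r ?add0r ?addr0 => h.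
    by rewrite mulfV ?gt_eqF.
  by rewrite mulNr mulfV ?gt_eqF.
exists (fun t => clamp (g t)); split.
- exact: clamp_continuous.
- by move=> t; exact: clamp_norm.
move=> k kn; have /cvgrPdist_lt/(_ 1 ltr01) := cg (x k).
apply: filterS => t /=; rewrite (gx k kn) ltr_norml /clamp /sgn_bool.
case: (b k) => /andP[h1 h2].
  have -> : Num.min 1 (g t) = 1 by apply/min_idPl; lra.
  by apply/max_idPr; lra.
by apply/max_idPl; rewrite ge_min; apply/orP; right; lra.
Qed.

(** A tree argument, one level at a time: given r_0, ..., r_(n-1) and for each of the
  2^n sign patterns an open set meeting A where they are constant with these
  signs, the next function takes both signs on each of these sets. *)
Lemma perfect_independent : A !=set0 -> exists r : nat -> K -> R,
  [/\ forall n, continuous (r n), forall n t, `|r n t| <= 1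
    & forall n (s : nat -> bool), exists2 t, A t & forall k, (k < n)%N -> r k t = sgn_bool (s k)].
Proof.
move=> A0.
pose ind n (f : nat -> K -> R) := forall s : nat -> bool, exists2 U, open U /\ U `&` A !=set0 &
  forall t, U t -> forall k, (k < n)%N -> f k t = sgn_bool (s k).
pose upd n (f : nat -> K -> R) g k := if k == n then g else f k.
pose P n f (g : K -> R) := [/\ continuous g, forall t, `|g t| <= 1
  & ind n f -> ind n.+1 (upd n f g)].
have [|r Hr] := @history_choice (K -> R) (fun _ => 0) P.
  move=> n f; have [indf|nind] := pselect (ind n f); last first.
    exists (fun _ => 0); split => //; first by move=> t; exact: cvg_cst.
    by move=> t; rewrite normr0 ler01.
  pose pat := (seq.seq bool : Type).
  have [U HU] := choice (fun s => let: ex_intro2 U hU hs := indf s in ex_intro _ U (conj hU hs)).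
  pose l := enum {: n.-tuple bool * bool}.
  pose q k : n.-tuple bool * bool := nth (nseq_tuple n false, false) l k.
  pose sg (w : n.-tuple bool) k := nth false w k.
  have [x [xinj Hx]] : exists x : nat -> K, injective x /\
      forall k, U (sg (q k).1) (x k) /\ A (x k).
    by apply: (perfect_injective (S := fun k => U (sg (q k).1))) => k; case: (HU (sg (q k).1)).
  have [g [cg g1 gx]] := finite_separation (fun k => (q k).2) (size l) xinj.
  exists g; split => // _ s.
  pose w : n.-tuple bool := [tuple s k | k < n].
  pose k := index (w, s n) l.
  have kl : (k < size l)%N by rewrite index_mem mem_enum.
  have qk : q k = (w, s n) by rewrite /q nth_index // mem_enum.
  have [Ux Ax] := Hx k; have [oU _] := HU (sg (q k).1).
  exists (U (sg (q k).1) `&` interior [set t | g t = sgn_bool (s n)]).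
    split; first by apply: openI; [exact: oU.1|exact: open_interior].
    exists (x k); split => //; split => //.
    by have := gx k kl; rewrite qk.
  move=> t [Ut /interior_subset gt] m; rewrite /upd ltnS leq_eqVlt.
  have [-> _|mn /= mn'] := eqVneq m n; first exact: gt.
  have [_ /(_ t Ut m mn') ->] := HU (sg (q k).1).
  by rewrite qk /sg /= -(tnth_nth _ w (Ordinal mn')) tnth_mktuple.
have rind n : ind n r.
  elim: n => [|n IH].
    move=> s; exists setT; last by [].
    by split; [exact: openT|rewrite setTI].
  have [_ _ H] := Hr n.
  have /H H' : ind n (nth (fun _ => 0) (mkseq r n)).
    move=> s; have [U HU Us] := IH s; exists U => // t Ut k kn.
    by rewrite nth_mkseq // Us.
  move=> s; have [U HU Us] := H' s; exists U => // t Ut k kn1.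
  rewrite -(Us t Ut k kn1) /upd; case: eqVneq => [-> //|kn].
  by rewrite nth_mkseq //; rewrite ltnS leq_eqVlt (negbTE kn) in kn1.
exists r; split.
- by move=> n; case: (Hr n).
- by move=> n; case: (Hr n).
- by move=> n s; have [U [oU [t [Ut At]]] Us] := rind n s; exists t => //; exact: Us.
Qed.

End independent_functions.

(** A cluster point of solutions for finite patterns of growing length solves the
  infinite pattern. *)
Lemma compact_independent (R : realType) (K : topologicalType) (r : nat -> K -> R) :
  compact [set: K] -> (forall n, continuous (r n)) ->
  (forall n (s : nat -> bool), exists t, forall k, (k < n)%N -> r k t = sgn_bool (s k)) ->
  forall s : nat -> bool, exists t, forall k, r k t = sgn_bool (s k).
Proof.
move=> cK cr rs s; have [u Hu] := choice (rs ^~ s).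
have [t [_ tu]] := cK (u @ \oo) _ filterT.
exists t => k; apply: contrapT => rkt.
pose e := `|r k t - sgn_bool (s k)|.
have e0 : 0 < e by rewrite normr_gt0 subr_eq0; apply/eqP.
have /cvgrPdist_lt/(_ _ e0) near_t := cr k t.
have tail : (u @ \oo) [set v | r k v = sgn_bool (s k)].
  by exists k.+1 => // n kn; exact: Hu.
have [v [/= rv]] := tu _ _ tail near_t.
by rewrite rv ltxx.
Qed.

(** * Compact spaces over which subprojectivity holds are scattered *)

Section real_sums.
Context {R : realType}.

Lemma ler_sum_widen (u : nat -> R) n p : (forall k, 0 <= u k) -> (n <= p)%N ->
  \sum_(k < n) u k <= \sum_(k < p) u k.
Proof.
move=> u0; elim: p => [|p IH]; first by rewrite leqn0 => /eqP ->.
rewrite leq_eqVlt => /predU1P[-> //|/IH /le_trans]; apply.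
by rewrite big_ord_recr lerDl.
Qed.

Lemma sum_split_at (u : nat -> R) n p : (n <= p)%N ->
  \sum_(k < p) u k = \sum_(k < n) u k + \sum_(k < p) (if (k < n)%N then 0 else u k).
Proof.
move=> np; rewrite (big_ord_widen _ u np) [X in _ = X + _]big_mkcond -big_split /=.
by apply: eq_bigr => k _; case: ifP; rewrite ?addr0 ?add0r.
Qed.

End real_sums.

Section necessity.
Context {R : realType} {F : numFieldType} (sc : scalars R F).
Context (hF : has_nonneg_suprema F) {K : topologicalType} (cK : compact [set: K]).
Context (X : completeNormedModType F).
Local Notation E := (C[hF](cK, X)).
Local Notation N := (nrm sc).
Local Notation "f $[ t ]" := (csp_eval hF cK X t f)
  (at level 1, left associativity, format "f $[ t ]").

Lemma subprojective_csp_fiber (t : K) : subprojective E -> subprojective X.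
Proof.
move=> spE Y cY iY.
pose J : {linear X -> E} :=
  HB.pack (@csp_const _ hF _ cK X)
      (GRing.isLinear.Build _ _ _ _ _ (@csp_const_linear _ hF _ cK X)).
apply: (@complemented_pullback _ _ sc X E J 1 1 Y _ cY iY ltr01 _ spE).
  move=> x; rewrite mul1r; apply: nrm_csp_le; first exact: nrm_ge0.
  by move=> s; exact: lexx.
by move=> y _; rewrite mul1r; exact: (nrm_csp_eval sc t (J y)).
Qed.

(** On a perfect subset there are independent functions r_k, and they span a copy Y
  of l_1 in C(K,X). A projection P onto an infinite-dimensional subspace Z of Y makes
  the coordinates of [P f] absolutely summable, uniformly for f in the unit ball,
  whereas those of vectors of Z can be made to sum to at least 1/2 in each of many
  successive blocks. *)
Lemma subprojective_csp_scattered (x0 : X) : x0 <> 0 -> metrizable R K ->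
  subprojective E -> scattered K.
Proof.
move=> x00 [d dm] spE A A0 cA; apply: contrapT => noiso.
have Aperf x : ~ isolated A x by move=> Ax; apply: noiso; exists x.
have [r [cr r1 rA]] := perfect_independent dm Aperf A0.
have rs : forall s : nat -> bool, exists t, forall k, r k t = sgn_bool (s k).
  apply: compact_independent => // n s; have [t _ Ht] := rA n s; by exists t.
have Nx00 := nrm_gt0 sc x00.
pose x1 := emb sc (N x0)^-1 *: x0.
have Nx1 : N x1 = 1 by rewrite nrmZr gtr0_norm ?invr_gt0 // mulVf ?gt_eqF.
have [phi [phi1 phix]] := hahn_banach sc x1.
have {}phix : phi x1 = 1 by rewrite phix Nx1 rmorph1.
have [s Hs] := rs (fun _ => true).
have [s' Hs'] := choice (fun n => rs (fun k => k != n)).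
pose y n : E := csp_scalar sc hF cK x1 (cr n).
(* Among the r_k only r_n distinguishes s from s' n, so half the difference of the
   values at these points is the n-th coordinate, and it is defined on all of C(K,X). *)
pose e0 n (f : E) : F^o := emb sc 2^-1 * phi (f$[s] - f$[s' n]).
have e0_lin n : linear (e0 n).
  move=> a f g; rewrite /e0.
  have -> : (a *: f + g)$[s] - (a *: f + g)$[s' n] =
      a *: (f$[s] - f$[s' n]) + (g$[s] - g$[s' n]).
    by rewrite !csp_evalP opprD addrACA scalerBr.
  by rewrite linearP mulrDr -scalerAr.
have [e eE] : exists e : nat -> {linear E -> F^o}, forall n f, e n f = e0 n f.
  pose e n : {linear E -> F^o} := HB.pack (e0 n) (GRing.isLinear.Build _ _ _ _ _ (e0_lin n)).
  by exists e.
have e_y n k : e n (y k) = (k == n)%:R.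
  rewrite eE /e0 !csp_scalarE Hs Hs' -scalerBl -rmorphB linearZ /= phix.
  rewrite [_ *: _]mulr1 -rmorphM /sgn_bool; case: (k == n) => /=.
    by rewrite (_ : 2^-1 * _ = 1 :> R) ?rmorph1 //; field.
  by rewrite subrr mulr0 rmorph0.
have e_le n f : N (e n f) <= N f.
  rewrite eE /e0 (@nrmZ _ _ sc F^o) nrm_scalar_emb ger0_norm; last lra.
  have := phi1 (f$[s] - f$[s' n]); have := nrmB sc (f$[s]) (f$[s' n]).
  have := nrm_csp_eval sc s f; have := nrm_csp_eval sc (s' n) f; lra.
have Ny n : N (y n) <= 1.
  by apply: nrm_csp_le => // t; rewrite csp_scalarE nrmZr Nx1 mulr1.
pose Y := closed_span sc y.
have cY : closed_subspace Y by exact: closed_span_subspace.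
have e_sum n m (a : nat -> F) :
    e n (\sum_(k < m) a k *: y k) = if (n < m)%N then a n else 0.
  rewrite linear_sum; case: ifP => nm.
    rewrite (bigD1 (Ordinal nm)) //= linearZ e_y eqxx /= [_ *: _]mulr1 big1 ?addr0 // => k.
    by rewrite -val_eqE /= => /negbTE kn; rewrite linearZ e_y kn /= scaler0.
  rewrite big1 // => k _; rewrite linearZ e_y.
  have -> : (k == n :> nat) = false.
    by apply: ltn_eqF; apply: leq_trans (ltn_ord k) _; rewrite leqNgt nm.
  by rewrite /= scaler0.
(* At a point where the r_k have the signs of the real, or of the imaginary, parts of
   the coefficients, these parts add up without cancellation. *)
have l1_part (part : F -> R) m (a : nat -> F) :
    (forall x z, part (x + z) = part x + part z) ->
    (forall c z, part (emb sc c * z) = c * part z) ->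
    (forall z : F, `|part z| <= N (z : F^o)) ->
    \sum_(k < m) `|part (a k)| <= N (\sum_(k < m) a k *: y k).
  move=> partD partZ part_le.
  have [t Ht] := rs (fun k => 0 <= part (a k)).
  apply: le_trans (nrm_csp_eval sc t _); rewrite linear_sum.
  under [X in _ <= N X] eq_bigr => k _ do rewrite csp_evalZ csp_scalarE Ht scalerA.
  rewrite -scaler_suml nrmZ Nx1 mulr1; apply: le_trans (part_le _).
  have part0 : part 0 = 0 by have := partD 0 0; rewrite addr0; lra.
  rewrite (big_morph part partD part0) -[leLHS]ger0_norm; last exact: sumr_ge0.
  rewrite le_eqVlt; apply/orP; left; apply/eqP; congr `|_|; apply: eq_bigr => k _.
  rewrite mulrC partZ /sgn_bool; case: leP => h; first by rewrite mul1r ger0_norm.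
  by rewrite mulN1r ltr0_norm.
have l1 m (a : nat -> F) :
    \sum_(k < m) N (a k : F^o) <= 2 * N (\sum_(k < m) a k *: y k).
  have := l1_part (rpart sc) m a (rpartD sc) (rpartZ sc) (nrm_rpart sc).
  have := l1_part (ipart sc) m a (ipartD sc) (ipartZ sc) (nrm_ipart sc).
  have : \sum_(k < m) N (a k : F^o) <=
      \sum_(k < m) `|rpart sc (a k)| + \sum_(k < m) `|ipart sc (a k)|.
    by rewrite -big_split; apply: ler_sum => k _; exact: nrm_parts.
  lra.
have iY : infinite_dimensional Y.
  apply: (infdim_independent (y := y)); first exact: closed_span_gen.
  move=> n a az k kn; apply: (@nrm_eq0 _ _ sc F^o); apply/eqP.
  rewrite eq_le nrm_ge0 andbT; have := l1 n a; rewrite az nrm0 mulr0; apply: le_trans.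
  rewrite (bigD1 (Ordinal kn)) //= lerDl; apply: sumr_ge0 => i _; exact: nrm_ge0.
have coord_sum z n : Y z -> \sum_(k < n) N (e k z) <= 2 * N z.
  move=> Yz; rewrite -subr_le0; apply: ltr_eps => c c0.
  have n0 : 0 < n%:R + 3 :> R by rewrite ltr_wpDl.
  have cn0 : 0 < c / (n%:R + 3) by rewrite divr_gt0.
  have [m [a]] := Yz _ cn0; set z' := \sum_(k < m) _ => zz'.
  have h1 : \sum_(k < n) N (e k z) <= \sum_(k < n) (N (e k z') + N (z - z')).
    apply: ler_sum => k _; apply: le_trans (nrm_le_dist sc (e k z) (e k z')) _.
    by rewrite -linearB lerD2l; exact: e_le.
  have h2 : \sum_(k < n) N (e k z') <= 2 * N z'.
    have := l1 (maxn n m) (fun k => if (k < m)%N then a k else 0).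
    rewrite -sum_pad ?leq_maxr // -/z'; apply: le_trans.
    under eq_bigr => k _ do rewrite e_sum.
    apply: (@ler_sum_widen _ (fun k => N ((if (k < m)%N then a k else 0) : F^o))).
      by move=> k; exact: nrm_ge0.
    exact: leq_maxl.
  move: h1; rewrite big_split /= sumr_const card_ord -[X in _ <= _ + X]mulr_natl.
  have := nrm_le_dist sc z' z; rewrite (nrm_distC sc z' z).
  by have := nrm_ge0 sc (z - z'); move: zz'; rewrite ltr_pdivlMr //; lra.
(* Vectors of Y are determined by their coordinates, in a quantitative way. *)
have recover z c : Y z -> 0 < c -> exists n, N z <= \sum_(k < n) N (e k z) + c.
  move=> Yz c0; have c40 : 0 < c / 4 by lra.
  have [m [a]] := Yz _ c40; set z' := \sum_(k < m) _ => zz'.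
  exists m.
  have Yz' : Y (z' - z) by apply: (subspaceB cY _ Yz); exact: closed_span_sum.
  have h1 : N z' <= \sum_(k < m) N (e k z').
    apply: le_trans (@nrm_sum _ _ sc E m (fun k => a k *: y k)) _.
    apply: ler_sum => k _; rewrite nrmZ e_sum ltn_ord -[leRHS]mulr1.
    by rewrite ler_wpM2l ?nrm_ge0.
  have h2 : \sum_(k < m) N (e k z') <= \sum_(k < m) N (e k z) + \sum_(k < m) N (e k (z' - z)).
    rewrite -big_split; apply: ler_sum => k _ /=.
    by rewrite linearB; exact: nrm_le_dist.
  have := coord_sum _ m Yz'; rewrite (nrm_distC sc z' z).
  have := nrm_le_dist sc z z'; lra.
have values z t : Y z -> z$[t] = phi (z$[t]) *: x1.
  move=> Yz; apply/eqP; rewrite -subr_eq0; apply/eqP/(@nrm_eq0 _ _ sc).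
  apply/eqP; rewrite eq_le nrm_ge0 andbT; apply: ltr_eps => c c0.
  have c20 : 0 < c / 2 by lra.
  have [m [a]] := Yz _ c20; set z' := \sum_(k < m) _ => zz'.
  have z't : z'$[t] = phi (z'$[t]) *: x1.
    rewrite /z' linear_sum.
    under eq_bigr => k _ do rewrite csp_evalZ csp_scalarE scalerA.
    by rewrite -scaler_suml [phi (_ *: _)]linearZ /= phix [_ *: 1]mulr1.
  have -> : z$[t] - phi (z$[t]) *: x1 = (z - z')$[t] - phi ((z - z')$[t]) *: x1.
    by rewrite !linearB scalerBl -z't opprB addrA subrK.
  have := nrmB sc ((z - z')$[t]) (phi ((z - z')$[t]) *: x1).
  rewrite nrmZ Nx1 mulr1; have := phi1 ((z - z')$[t]).
  have := nrm_csp_eval sc t (z - z'); lra.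
have [Z [ZY cZ iZ [P [Pc Pid PZ]]]] := spE Y cY iY.
have [CP CP0 PC] := continuous_bounded sc Pc.
have PfZ f : Z (P f) by rewrite -PZ; exists f.
have Pz z : Z z -> P z = z by rewrite -{1}PZ => -[f _ <-]; rewrite Pid.
have PD f n : \sum_(k < n) N (e k (P f)) <= 2 * CP * N f.
  apply: le_trans (coord_sum _ n (ZY _ (PfZ f))) _.
  by rewrite -mulrA ler_pM2l //; exact: PC.
have block m : exists u : E * nat, [/\ Z u.1, N u.1 = 1,
    forall k, (k < m)%N -> e k u.1 = 0, (m <= u.2)%N
    & 2^-1 <= \sum_(k < u.2) N (e k u.1)].
  have cZm : closed_subspace (Z `&` [set x | forall k, (k < m)%N -> e k x = 0]).
    by apply: (@closed_subspace_kers _ _ _ sc) => // k; exists 1 => x; rewrite mul1r.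
  have iZm : infinite_dimensional (Z `&` [set x | forall k, (k < m)%N -> e k x = 0]).
    by apply: infdim_kers => //; case: cZ.
  have [Zm0 _ _] := cZm.
  have [v Zv v0] := infdim_nonzero Zm0 iZm.
  have Nv := nrm_gt0 sc v0.
  pose w := emb sc (N v)^-1 *: v.
  have Nw : N w = 1 by rewrite nrmZr gtr0_norm ?invr_gt0 // mulVf ?gt_eqF.
  have [Zw ew] := subspaceZ (emb sc (N v)^-1) cZm Zv.
  have h : 0 < (2^-1 : R) by lra.
  have [n Hn] := recover w _ (ZY _ Zw) h.
  exists (w, maxn m n); split => //=; first exact: leq_maxl.
  have : \sum_(k < n) N (e k w) <= \sum_(k < maxn m n) N (e k w).
    apply: (@ler_sum_widen _ (fun k => N (e k w))); last exact: leq_maxr.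
    by move=> k; exact: nrm_ge0.
  by move: Hn; rewrite Nw; lra.
have [g Hg] := choice block.
pose mm := fix mm j := if j is i.+1 then (g (mm i)).2 else 0%N.
pose z j := (g (mm j)).1.
have Zz j : Z (z j) by case: (Hg (mm j)).
have Nz j : N (z j) = 1 by case: (Hg (mm j)).
have ez j k : (k < mm j)%N -> e k (z j) = 0 by case: (Hg (mm j)) => _ _ + _ _; apply.
have mm_le j : (mm j <= mm j.+1)%N by case: (Hg (mm j)).
have zsum j : 2^-1 <= \sum_(k < mm j.+1) N (e k (z j)) by case: (Hg (mm j)).
(* The signs of the coordinates of z_j in its own block. *)
pose w j k : F := if (k < mm j)%N then 0 else `|e k (z j)| / e k (z j).
have w1 j k : N (w j k : F^o) <= 1.
  rewrite nrm_le rmorph1 /w; case: ifP => _; first by rewrite normr0.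
  have [->|h] := eqVneq (e k (z j)) 0; first by rewrite normr0 mul0r normr0.
  by rewrite normrM normfV normr_id mulfV ?normr_eq0.
pose T0 j (f : E) : F^o := \sum_(k < mm j.+1) w j k * e k (P f).
have T0_lin j : linear (T0 j).
  move=> a f f'; rewrite /T0 scaler_sumr -big_split; apply: eq_bigr => k _ /=.
  by rewrite !linearP mulrDr -scalerAr.
have [T TE] : exists T : nat -> {linear E -> F^o}, forall j f, T j f = T0 j f.
  pose T j : {linear E -> F^o} := HB.pack (T0 j) (GRing.isLinear.Build _ _ _ _ _ (T0_lin j)).
  by exists T.
have T_sum J f : \sum_(j < J) N (T j f) <= \sum_(k < mm J) N (e k (P f)).
  elim: J => [|J IH]; first by rewrite !big_ord0.
  rewrite big_ord_recr (sum_split_at (fun k => N (e k (P f))) (mm_le J)).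
  apply: lerD IH _; rewrite TE /T0.
  apply: le_trans (@nrm_sum _ _ sc F^o _ (fun k => w J k * e k (P f))) _.
  apply: ler_sum => k _; have := w1 J k; rewrite (@nrmZ _ _ sc F^o) /w; case: ifP => _ h.
    by rewrite nrm0 mul0r.
  by rewrite ler_piMl ?nrm_ge0.
have T_z j : 2^-1 <= N (T j (z j)).
  have -> : T j (z j) = emb sc (\sum_(k < mm j.+1) N (e k (z j))).
    rewrite rmorph_sum TE /T0; apply: eq_bigr => k _; rewrite Pz //.
    rewrite (nrmE sc (e k (z j))) /w; case: ifP => [/ez ->|_]; first by rewrite mul0r normr0.
    have [->|h] := eqVneq (e k (z j)) 0; first by rewrite normr0 mulr0.
    by rewrite divfK.
  by rewrite nrm_scalar_emb (le_trans _ (ler_norm _)).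
have part_continuous (part : F -> R) j : (forall x v, part (x + v) = part x + part v) ->
    (forall v : F, `|part v| <= N (v : F^o)) ->
    continuous (fun t => part (phi ((z j)$[t]))).
  move=> partD part_le t; apply/cvgrPdist_lt => c c0.
  have := csp_eval_near sc (z j) t c0; apply: filterS => t' /=; apply: le_lt_trans.
  have partB x v : part (x - v) = part x - part v.
    by have := partD (x - v) v; rewrite subrK; lra.
  rewrite -partB; apply: le_trans (part_le _) _.
  by rewrite -linearB; exact: phi1.
have cre j := part_continuous (rpart sc) j (rpartD sc) (nrm_rpart sc).
have cim j := part_continuous (ipart sc) j (ipartD sc) (nrm_ipart sc).
have phi_z j t : N (phi ((z j)$[t])) <= 1.
  by rewrite -(Nz j) (le_trans (phi1 _)) ?nrm_csp_eval.
pose U j := csp_scalar sc hF cK x1 (cre j).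
pose V j := csp_scalar sc hF cK x1 (cim j).
have zUV j : z j = iunit sc *: V j + U j.
  apply: csp_eval_inj => t; rewrite values; last exact: ZY.
  rewrite csp_evalP !csp_scalarE [iunit sc *: _]scalerA -scalerDl; congr (_ *: _).
  by rewrite addrC -partsE.
have TUV j : 2^-1 <= N (T j (U j)) + N (T j (V j)).
  apply: le_trans (T_z j) _; rewrite zUV linearP.
  apply: le_trans (@nrmD _ _ sc F^o _ _) _; rewrite addrC lerD2l (@nrmZ _ _ sc F^o).
  by rewrite ler_piMl ?nrm_ge0 // nrm_le rmorph1 iunit_le1.
pose D := 2 * CP.
have D0 : 0 <= D by rewrite mulr_ge0 // ltW.
pose m := (Num.truncn (8 * D)).+1.
have mD : 8 * D < m%:R by rewrite truncnS_gt.
have m0 : 0 < (m%:R : R) by rewrite ltr0n.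
pose c : R := (2 * m%:R)^-1.
have c0 : 0 <= c by rewrite invr_ge0 mulr_ge0 // ltW.
(* This J is the largest number with J c^2 <= 1/2; then c J / 2 = m / 2 exceeds 4 D. *)
pose J := (2 * m * m)%N.
have JE : J%:R = 2 * m%:R * m%:R :> R by rewrite !natrM.
have mn0 : (m%:R : R) != 0 by rewrite gt_eqF.
have Jc : J%:R * c ^+ 2 <= 2^-1.
  by rewrite JE /c le_eqVlt; apply/orP; left; apply/eqP; field.
have TD f : \sum_(j < J) N (T j f) <= D * N f by exact: le_trans (T_sum J f) (PD f _).
have hU := riesz_product_sum cre Nx1 D0 c0 Jc
  (fun j t => le_trans (nrm_rpart sc _) (phi_z j t)) TD.
have hV := riesz_product_sum cim Nx1 D0 c0 Jc
  (fun j t => le_trans (nrm_ipart sc _) (phi_z j t)) TD.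
have : J%:R * 2^-1 <= \sum_(j < J) N (T j (U j)) + \sum_(j < J) N (T j (V j)).
  rewrite -big_split -[J in J%:R]card_ord mulr_natl -sumr_const.
  by apply: ler_sum => j _; exact: TUV.
move=> /(ler_wpM2l c0); rewrite mulrDr.
have -> : c * (J%:R * 2^-1) = m%:R / 2 by rewrite JE /c; field.
move: hU hV; rewrite -/(U _) -/(V _) => hU hV; lra.
Qed.

Theorem subprojective_csp_iff : infinite_dimensional [set: X] ->
  infinite_dimensional [set: E] -> metrizable R K ->
  (scattered K /\ subprojective X <-> subprojective E).
Proof.
move=> iX iE mK; split=> [[scK spX]|spE]; first exact: (scattered_csp_subprojective sc).
have [x0 _ x00] := infdim_nonzero (I : [set: X] 0) iX.
have [f _ f0] := infdim_nonzero (I : [set: E] 0) iE.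
have [t _] : exists t : K, True.
  apply: contrapT => K0; apply: f0; apply: csp_ext => t; exfalso; apply: K0.
  by exists t.
split; first exact: subprojective_csp_scattered x00 mK spE.
exact: subprojective_csp_fiber t spE.
Qed.

End necessity.

Theorem theorem4p1 (R : realType) (K : topologicalType)
    (cK : compact [set: K]) (mK : metrizable R K) :
  (forall X : completeNormedModType R,
     infinite_dimensional [set: X] ->
     infinite_dimensional [set: C[real_has_nonneg_suprema R](cK, X)] ->
     (scattered K /\ subprojective X <->
      subprojective C[real_has_nonneg_suprema R](cK, X)))
  /\
  (forall X : completeNormedModType R[i],
     infinite_dimensional [set: X] ->
     infinite_dimensional [set: C[complex_has_nonneg_suprema R](cK, X)] ->
     (scattered K /\ subprojective X <->
      subprojective C[complex_has_nonneg_suprema R](cK, X))).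
Proof.
split=> X iX iE.
  exact: (subprojective_csp_iff (real_scalars R)).
exact: (subprojective_csp_iff (complex_scalars R)).
Qed.
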